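(* Let $G$ be a locally finite graph and $r\ge 3$ an integer. Then the following are equivalent: (i) $G$ is $r$-locally chordal. (ii) $G$ has an $r$-acyclic clique graph (equivalently: $G$ admits an $r$-acyclic graph-decomposition into its maximal cliques). (iii) $G$ has an $r$-acyclic canonical region representation (equivalently: $G$ admits a canonical $r$-acyclic graph-decomposition into cliques). (iv) $G$ has an $r$-acyclic region representation (equivalently: $G$ admits an $r$-acyclic graph-decomposition into cliques).
   Context: All graphs are simple and possibly infinite; locally finite means every vertex has finite degree. The ball $B_{r/2}(v)$ is the subgraph of $G$ whose vertices are those at distance at most $r/2$ from $v$ and whose edges are the edges of $G$ for which the sum of the distances of the endpoints to $v$ is strictly less than $r$. A graph is chordal if each of its cycles of length at least $4$ has a chord; $G$ is $r$-locally chordal if every ball $B_{r/2}(v)$, $v\in V(G)$, is chordal. A clique is a vertex-subset inducing a complete subgraph (the empty set is allowed). A region of $H$ is a nonempty connected subgraph. A region representation of $G$ over a graph $H$ is a map $v\mapsto H_v$ assigning to each vertex of $G$ a region of $H$ such that, for distinct $u,v$, $uv\in E(G)$ iff $H_u\cap H_v\ne\emptyset$. It is $r$-acyclic if for every $X\subseteq V(G)$ with $|X|\le r$ the union $H_X=\bigcup_{x\in X}H_x$ is acyclic. It is canonical if there is an action of the automorphism group $\mathrm{Aut}(G)$ on $H$ (by graph automorphisms) with $\gamma\cdot H_v=H_{\gamma(v)}$ for all $\gamma\in\mathrm{Aut}(G)$, $v\in V(G)$. A graph-decomposition of $G$ is a pair $(H,\mathcal V)$ of a graph $H$ and a family $\mathcal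 V=(V_h)_{h\in V(H)}$ of vertex-subsets of $G$ such that $G=\bigcup_hG[V_h]$ and, for every vertex $v$, $H[W_v]$ is connected, where $W_v=\{h: v\in V_h\}$. It comes with a fixed choice of co-parts $H_v$, each a connected spanning subgraph of $H[W_v]$. It is $r$-acyclic if $\bigcup_{x\in X}H_x$ is acyclic for every $X\subseteq V(G)$ with $|X|\le r$. It is into cliques if every $V_h$ is a clique of $G$, and into the maximal cliques of $G$ if $h\mapsto V_h$ is a bijection from $V(H)$ to the set $K(G)$ of inclusion-maximal cliques of $G$. It is canonical if there is an action of $\mathrm{Aut}(G)$ on $H$ with $\gamma(V_h)=V_{\gamma\cdot h}$ and $\gamma\cdot H_v=H_{\gamma(v)}$ for all $\gamma,h,v$. Let $\mathbf K(G)$ be the graph with vertex set $K(G)$ in which two distinct maximal cliques are adjacent iff they intersect, and let $K_G(v)$ be the set of maximal cliques of $G$ containing $v$. A clique graph of $G$ is a spanning subgraph $H$ of $\mathbf K(G)$ such that $H[K_G(v)]$ is connected for every vertex $v$ of $G$ (equivalently, $v\mapsto H_v:=H[K_G(v)]$ is a region representation of $G$ over $H$); it is $r$-acyclic if this region representation is $r$-acyclic. *)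

(* Defs.v *)
From mathcomp Require Import all_boot.
From mathcomp Require Import boolp classical_sets functions cardinality.

Set Implicit Arguments.
Unset Strict Implicit.
Unset Printing Implicit Defensive.
#[local] Obligation Tactic := idtac.

Local Open Scope classical_set_scope.
Local Open Scope card_scope.

Record graph := Graph {
  vertex :> Type;
  adj : vertex -> vertex -> Prop;
  adj_sym : forall x y, adj x y -> adj y x;
  adj_irrefl : forall x, ~ adj x x }.

Arguments adj {g}.

Definition locally_finite (G : graph) : Prop :=
  forall v : G, finite_set [set w | adj v w].

Definition walk (G : graph) (x y : G) (n : nat) : Prop :=
  exists w : nat -> G,
    [/\ w 0 = x, w n = y & forall i, i < n -> adj (w i) (w i.+1)].

(* There is no [n] with [is_dist x y n] when [x] and [y] lie in different
   components. *)
Definition is_dist (G : graph) (x y : G) (n : nat) : Prop :=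
  walk x y n /\ forall m, walk x y m -> n <= m.

(* The empty graph counts as connected; nonemptiness is required separately. *)
Definition connected (G : graph) : Prop :=
  forall x y : G, exists n, walk x y n.

(* [ordS] is the cyclic successor on ['I_n]. *)
Definition is_cycle (G : graph) (n : nat) (c : 'I_n -> G) : Prop :=
  [/\ 3 <= n, injective c & forall i, adj (c i) (c (ordS i))].

Definition acyclic (G : graph) : Prop :=
  forall n (c : 'I_n -> G), ~ is_cycle c.

Definition has_chord (G : graph) (n : nat) (c : 'I_n -> G) : Prop :=
  exists i j : 'I_n, [/\ j != ordS i, i != ordS j & adj (c i) (c j)].

Definition chordal (G : graph) : Prop :=
  forall n (c : 'I_n -> G), 4 <= n -> is_cycle c -> has_chord c.

Record subgraph (G : graph) := Subgraph {
  sverts : set G;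
  sedge : G -> G -> Prop;
  sedge_adj : forall x y, sedge x y -> adj x y;
  sedge_sym : forall x y, sedge x y -> sedge y x;
  sedge_vert : forall x y, sedge x y -> sverts x }.

Section Subgraphs.
Variable G : graph.

Program Definition graph_of_subgraph (S : subgraph G) : graph :=
  @Graph (set_type (sverts S)) (fun x y => sedge S (\val x) (\val y)) _ _.
Next Obligation. by move=> S x y; apply: sedge_sym. Qed.
Next Obligation. by move=> S x /sedge_adj; apply: adj_irrefl. Qed.

Program Definition whole : subgraph G := @Subgraph G setT adj _ _ _.
Next Obligation. by []. Qed.
Next Obligation. exact: adj_sym. Qed.
Next Obligation. by []. Qed.

(* S[A] *)
Program Definition restrict (S : subgraph G) (A : set G) : subgraph G :=
  @Subgraph G (sverts S `&` A) (fun x y => [/\ A x, A y & sedge S x y]) _ _ _.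
Next Obligation. by move=> S A x y [_ _ /sedge_adj]. Qed.
Next Obligation. by move=> S A x y [? ? /sedge_sym]. Qed.
Next Obligation. by move=> S A x y [? _ /sedge_vert]. Qed.

Definition induced (A : set G) : subgraph G := restrict whole A.

Program Definition union_subgraph (I : Type) (X : set I)
    (F : I -> subgraph G) : subgraph G :=
  @Subgraph G (\bigcup_(i in X) sverts (F i))
    (fun x y => exists2 i, X i & sedge (F i) x y) _ _ _.
Next Obligation. by move=> I X F x y [i _ /sedge_adj]. Qed.
Next Obligation. by move=> I X F x y [i Xi /sedge_sym]; exists i. Qed.
Next Obligation. by move=> I X F x y [i Xi /sedge_vert]; exists i. Qed.

Definition spanning (S T : subgraph G) : Prop :=
  sverts S = sverts T /\ forall x y, sedge S x y -> sedge T x y.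

Lemma is_dist_adj (v x y : G) i j :
  is_dist v x i -> is_dist v y j -> adj x y -> j <= i.+1.
Proof.
move=> [[w [w0 wi wadj]] _] [_ jmin] xy; apply: jmin.
exists (fun k => if k <= i then w k else y); split => //=; first by rewrite ltnn.
move=> k; rewrite ltnS => ki; rewrite ki; case: ltnP => [|ik]; first exact: wadj.
by have -> : k = i; [apply/eqP; rewrite eqn_leq ki | rewrite wi].
Qed.

(* The ball B_{r/2}(v). *)
Program Definition ball (r : nat) (v : G) : subgraph G :=
  @Subgraph G [set x | exists2 i, is_dist v x i & i.*2 <= r]
    (fun x y => adj x y /\
       exists i j, [/\ is_dist v x i, is_dist v y j & i + j < r]) _ _ _.
Next Obligation. by move=> r v x y []. Qed.
Next Obligation.
move=> r v x y [xy [i [j [vi vj ij]]]]; split; first exact: adj_sym.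
by exists j, i; rewrite addnC.
Qed.
Next Obligation.
move=> r v x y [xy [i [j [vi vj ij]]]]; exists i => //.
apply: leq_trans ij; rewrite -addnn -addnS leq_add2l.
exact: is_dist_adj vj vi (adj_sym xy).
Qed.

Definition locally_chordal (r : nat) : Prop :=
  forall v : G, chordal (graph_of_subgraph (ball r v)).

Definition clique (A : set G) : Prop :=
  forall x y, A x -> A y -> x <> y -> adj x y.

(* K(G) *)
Definition max_cliques : set (set G) :=
  [set A | clique A /\ forall B, clique B -> A `<=` B -> B = A].

(* The graph on K(G) in which distinct maximal cliques are adjacent iff they
   intersect. *)
Program Definition clique_intersection_graph : graph :=
  @Graph (set_type max_cliques)
    (fun A B => A <> B /\ \val A `&` \val B !=set0) _ _.
Next Obligation. by move=> A B [AB AB0]; rewrite setIC; split=> // /esym. Qed.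
Next Obligation. by move=> A []. Qed.

(* K_G(v) *)
Definition cliques_at (v : G) : set clique_intersection_graph :=
  [set A | (\val A : set G) v].

End Subgraphs.

(* v |-> H[K_G(v)] *)
Definition clique_region (G : graph) (H : subgraph (clique_intersection_graph G))
    (v : G) : subgraph (clique_intersection_graph G) :=
  restrict H (cliques_at v).

Definition clique_graph (G : graph)
    (H : subgraph (clique_intersection_graph G)) : Prop :=
  spanning H (whole (clique_intersection_graph G)) /\
  forall v, connected (graph_of_subgraph (clique_region H v)).

Definition region (H : graph) (S : subgraph H) : Prop :=
  sverts S !=set0 /\ connected (graph_of_subgraph S).

Definition region_representation (G H : graph) (R : G -> subgraph H) : Prop :=
  (forall v, region (R v)) /\
  forall u v, u <> v -> (adj u v <-> sverts (R u) `&` sverts (R v) !=set0).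

(* Used for region representations and for the co-parts of
   graph-decompositions alike. *)
Definition r_acyclic (r : nat) (G H : graph) (R : G -> subgraph H) : Prop :=
  forall X : set G, X #<= `I_r ->
    acyclic (graph_of_subgraph (union_subgraph X R)).

Record aut (G : graph) := Aut {
  aut_fun :> G -> G;
  aut_bij : bijective aut_fun;
  aut_adj : forall x y, adj (aut_fun x) (aut_fun y) <-> adj x y }.

Program Definition aut_id (G : graph) : aut G := @Aut G id _ _.
Next Obligation. by move=> G; exists id. Qed.
Next Obligation. by []. Qed.

Program Definition aut_comp (G : graph) (f g : aut G) : aut G :=
  @Aut G (f \o g) _ _.
Next Obligation. by move=> G f g; apply: bij_comp; apply: aut_bij. Qed.
Next Obligation. by move=> G f g x y /=; rewrite !aut_adj. Qed.

(* An action of Aut(G) on H by graph automorphisms. *)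
Definition aut_action (G H : graph) (act : aut G -> aut H) : Prop :=
  (forall h, act (aut_id G) h = h) /\
  (forall f g h, act (aut_comp f g) h = act f (act g h)).

Program Definition image_subgraph (H : graph) (f : aut H) (S : subgraph H) :
    subgraph H :=
  @Subgraph H (f @` sverts S)
    (fun x y => exists a b, [/\ sedge S a b, f a = x & f b = y]) _ _ _.
Next Obligation. by move=> H f S x y [a [b [/sedge_adj ab <- <-]]]; apply/aut_adj. Qed.
Next Obligation. by move=> H f S x y [a [b [/sedge_sym ba <- <-]]]; exists b, a. Qed.
Next Obligation. by move=> H f S x y [a [b [/sedge_vert Sa <- _]]]; exists a. Qed.

Definition canonical_representation (G H : graph) (R : G -> subgraph H) : Prop :=
  exists act : aut G -> aut H, aut_action act /\
    forall (f : aut G) (v : G), image_subgraph (act f) (R v) = R (f v).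

(* [V] gives the parts V_h and [R] the chosen co-parts H_v. *)
Definition graph_decomposition (G H : graph) (V : H -> set G)
    (R : G -> subgraph H) : Prop :=
  let W (v : G) : set H := [set h | V h v] in
  [/\ whole G = union_subgraph setT (fun h => induced (V h)),
      forall v, connected (graph_of_subgraph (induced (W v)))
    & forall v, spanning (R v) (induced (W v)) /\
                connected (graph_of_subgraph (R v))].

Definition into_cliques (G H : graph) (V : H -> set G) : Prop :=
  forall h, clique (V h).

Definition into_max_cliques (G H : graph) (V : H -> set G) : Prop :=
  set_bij setT (@max_cliques G) V.

Definition canonical_decomposition (G H : graph) (V : H -> set G)
    (R : G -> subgraph H) : Prop :=
  exists act : aut G -> aut H, aut_action act /\
    forall f : aut G,
      (forall h, f @` V h = V (act f h)) /\
      (forall v, image_subgraph (act f) (R v) = R (f v)).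

(* Main.v *)
From Stdlib Require Import Relation_Operators Operators_Properties.
Require Import Defs.
From mathcomp Require Import all_boot.
From mathcomp Require Import boolp classical_sets functions cardinality.
From mathcomp Require Import finmap zify.

Set Implicit Arguments.
Unset Strict Implicit.
Unset Printing Implicit Defensive.

Local Open Scope classical_set_scope.
Local Open Scope card_scope.

#[local] Obligation Tactic := idtac.

(** An acyclic graph is handled through cuts: it is a graph in which, for every
    edge, some set of vertices is left by that edge only ([acyclicP]).  Cuts of
    two graphs differ by a constant on a connected common part, so they can be
    compared and glued, which replaces all reasoning about paths in trees.

    From regions to balls.  Suppose that [G] has an [r]-acyclic region
    representation and that a cycle of the ball around [v] has no chord.  Walk
    from [v] along geodesics to the vertices of the cycle.  The geodesics to the
    two ends of an edge of the ball have at most [r] vertices together, so their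
    regions form a tree, and cuts of these trees, normalised at [v], are
    compatible along every edge of the cycle.  An edge of a tree that lies in one
    region of the cycle only is thereby crossed exactly once by a closed walk
    through the regions of the cycle, which is impossible
    ([cycle_chord_of_walks], [regions_locally_chordal]).

    From balls to regions.  Local chordality is used in two forms: the closed
    neighbourhoods of vertices are chordal, and cycles of length at most [r]
    have chords ([nbhd_chordal], [short_cycle_chord]).  Both representations of
    [G] are built over graphs whose nodes are cliques, the region of [v] being
    induced by the nodes containing [v].  The common neighbourhood of a clique
    [S] falls into components, here called branches at [S], and the graph has a
    star on the branches at every [S] ([star_system]).  By induction from large
    cliques to small ones, the nodes containing a given clique are connected
    ([label_connected]).  A cycle in the region of [x] would have an edge whose
    two labels meet in a set [S] of least size; since the neighbourhood of [x] is
    chordal, branches at [S] cannot be connected around [S] inside it, so that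
    the cycle would cross the star at [S] only once ([label_acyclic]).  For the
    union of at most [r] regions, cuts of the single regions at a given edge
    differ by constants on their connected overlaps; these constants form a
    cocycle on [G], which vanishes on triangles, as three pairwise adjacent
    vertices share a node, and hence on all closed walks with at most [r]
    vertices, as these are split into triangles by chords ([cocycle_exact],
    [label_r_acyclic]).

    For the clique graph the nodes are the maximal cliques, and each star joins
    chosen representatives of the branches ([exists_star_clique_graph]).  For the
    canonical representation the nodes are all nonempty cliques, and [S] itself
    is the centre of its star.  The other end in a branch has to be a clique
    invariant under the automorphisms of that branch; it is found by removing all
    simplicial vertices again and again until a clique is left ([core_clique],
    [core_graph_star], [core_graph_canonical]). *)

(** * Reachability, geodesics and cyclic invariants *)

Notation reach E := (clos_refl_trans _ E).

Section Reach.
Variable T : Type.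
Implicit Types (E F : T -> T -> Prop) (P : T -> Prop).

Lemma reach_mono E F a b :
  (forall x y, E x y -> F x y) -> reach E a b -> reach F a b.
Proof.
move=> EF; elim=> [x y /EF|x|x y z _ xy _ yz];
  [exact: rt_step|exact: rt_refl|exact: rt_trans xy yz].
Qed.

Lemma reach_sym E a b : (forall x y, E x y -> E y x) -> reach E a b -> reach E b a.
Proof.
move=> Esym; elim=> [x y /Esym|x|x y z _ yx _ zy];
  [exact: rt_step|exact: rt_refl|exact: rt_trans zy yx].
Qed.

Lemma reach_invariant E P a b :
  (forall x y, E x y -> P x -> P y) -> reach E a b -> P a -> P b.
Proof. by move=> EP; elim=> [x y /EP|//|x y z _ xy _ yz /xy]. Qed.

Lemma last_exit E P a b : reach E a b -> P a -> ~ P b ->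
  exists s t, [/\ E s t, P s, ~ P t &
                  reach (fun x y => [/\ E x y, ~ P x & ~ P y]) t b].
Proof.
move/(clos_rt_rtn1 _ _ _ _); elim=> [//|y z yz _ IH Pa nPz].
have [Py|nPy] := pselect (P y).
  by exists y, z; split=> //; apply: rt_refl.
have [s [t [st Ps nPt ty]]] := IH Pa nPy.
by exists s, t; split=> //; apply: rt_trans ty _; apply: rt_step.
Qed.

(** A shortest walk repeats no vertex and has no shortcut. *)
Lemma geodesic E a b : reach E a b ->
  exists n (w : nat -> T),
    [/\ w 0 = a, w n = b, forall i, i < n -> E (w i) (w i.+1),
        forall i j, i < j <= n -> w i <> w j
      & forall i j, i.+1 < j <= n -> ~ E (w i) (w j)].
Proof.
pose walks c n := exists w : nat -> T,
  [/\ w 0 = a, w n = c & forall i, i < n -> E (w i) (w i.+1)].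
move=> ab.
have ex : exists n, `[< walks b n >].
  elim: (clos_rt_rtn1 _ _ _ _ ab) => [|y z yz _ [n /asboolP[w [w0 wn wE]]]].
    by exists 0; apply/asboolP; exists (fun=> a); split.
  exists n.+1; apply/asboolP; exists (fun k => if k <= n then w k else z).
  split=> /=; [by []|by rewrite ltnn|move=> i; rewrite ltnS => ile].
  rewrite ile; case: ltnP => [/wE//|nlei].
  have in_ : i = n by apply/eqP; rewrite eqn_leq ile nlei.
  by rewrite in_ wn.
pose n := ex_minn ex.
have [w [w0 wn wE]] : walks b n by rewrite /n; case: ex_minnP => m /asboolP.
have nmin m : walks b m -> n <= m.
  by move=> /asboolP wm; rewrite /n; case: ex_minnP => k _; apply.
clearbody n; exists n, w; split=> // i j /andP[ij jn].
- move=> wij; suff: n <= n - (j - i) by lia.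
  apply: nmin; exists (fun k => if k <= i then w k else w (k + (j - i))).
  split=> [//||k kn]; case: ifP => kle.
  + rewrite -wn; have e : n - (j - i) = i by lia.
    by rewrite e wij; congr w; lia.
  + by rewrite -wn; congr w; lia.
  + case: ifP => kle'; first by apply: wE; lia.
    have ki : k = i by lia.
    have e : i.+1 + (j - i) = j.+1 by lia.
    by rewrite ki wij e; apply: wE; lia.
  + case: ifP => kle'; first by lia.
    by rewrite addSn; apply: wE; lia.
- move=> wij; suff: n <= n - (j - i.+1) by lia.
  apply: nmin; exists (fun k => if k <= i then w k else w (k + (j - i.+1))).
  split=> [//||k kn]; case: ifP => kle.
  + by exfalso; lia.
  + by rewrite -wn; congr w; lia.
  + case: ifP => kle'; first by apply: wE; lia.
    have ki : k = i by lia.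
    by rewrite ki; have -> : i.+1 + (j - i.+1) = j by lia.
  + case: ifP => kle'; first by lia.
    by rewrite addSn; apply: wE; lia.
Qed.

End Reach.

Lemma val_ordS n (i : 'I_n) : val (ordS i) = if i.+1 == n then 0 else i.+1.
Proof.
rewrite /=; case: eqP => [->|ne]; first by rewrite modnn.
by rewrite modn_small //; have := ltn_ord i; lia.
Qed.

(** Going once around the cyclic order from the successor of [i] to [i] takes
    every step but the one leaving [i]. *)
Lemma cycle_invariant n (P : 'I_n -> Prop) (i : 'I_n) :
  (forall j, j != i -> (P j <-> P (ordS j))) -> (P i <-> P (ordS i)).
Proof.
move=> PS; have n0 : 0 < n by apply: leq_ltn_trans (ltn_ord i).
pose o k : 'I_n := Ordinal (ltn_pmod (i + k.+1) n0).
have oS k : ordS (o k) = o k.+1.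
  by apply: val_inj; rewrite /= -addn1 modnDml addn1 -addnS.
have Po k : k < n -> (P (o 0) <-> P (o k)).
  elim: k => [//|k IH kn]; rewrite IH ?(ltnW kn)// -oS; apply: PS.
  apply/eqP => /(congr1 val) /= /eqP; rewrite -{2}(modn_small (ltn_ord i)).
  by rewrite -{2}(addn0 i) eqn_modDl mod0n modn_small.
have <- : o 0 = ordS i by apply: val_inj; rewrite /= addn1.
have -> : P i = P (o n.-1); last by rewrite -Po // prednK.
by congr P; apply: val_inj; rewrite /= prednK // modnDr modn_small.
Qed.

Lemma ordS_neq n (i : 'I_n) : 1 < n -> ordS i != i.
Proof.
move=> n1; apply/eqP => /(congr1 val); rewrite val_ordS.
by case: eqP => /=; lia.
Qed.

Lemma ordS2_neq n (i : 'I_n) : 2 < n -> ordS (ordS i) != i.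
Proof.
move=> n2; apply/eqP => /(congr1 val); rewrite !val_ordS.
by do 2 case: eqP => /=; lia.
Qed.

Lemma ordS3_neq n (i : 'I_n) : 3 < n -> ordS (ordS (ordS i)) != i.
Proof.
move=> n3; apply/eqP => /(congr1 val); rewrite !val_ordS.
by do 3 case: eqP => /=; lia.
Qed.

(** * Relational forms of connectedness and acyclicity *)

Definition edge_of (T : Type) (s t a b : T) : bool :=
  `[< (a = s /\ b = t) \/ (a = t /\ b = s) >].

(** For an irreflexive symmetric relation this is acyclicity.  Only the edges
    impose a condition: for other pairs a constant [f] will do. *)
Definition forest (T : Type) (E : T -> T -> Prop) : Prop :=
  forall s t, exists f : T -> bool,
    forall a b, E a b -> f a (+) f b = edge_of s t a b.

Lemma forest_sub (T : Type) (E F : T -> T -> Prop) :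
  (forall a b, E a b -> F a b) -> forest F -> forest E.
Proof. by move=> EF Ff s t; have [f fE] := Ff s t; exists f => a b /EF/fE. Qed.

Lemma subgraph_eq (G : graph) (S T : subgraph G) :
  sverts S = sverts T -> sedge S = sedge T -> S = T.
Proof.
case: S T => [A E p q u] [B F p' q' u'] /= eAB eEF; move: p q u p' q' u'.
rewrite eAB eEF => p q u p' q' u'; congr Subgraph; exact: Prop_irrelevance.
Qed.

Lemma cycle_edge_neq (T : Type) n (c : 'I_n -> T) i j :
  3 <= n -> injective c -> j != i ->
  ~~ edge_of (c i) (c (ordS i)) (c j) (c (ordS j)).
Proof.
move=> n3 cinj ji; apply/asboolP => -[[/cinj e _]|[/cinj e1 /cinj e2]].
  by rewrite e eqxx in ji.
by move: (ordS2_neq i n3); rewrite -e1 e2 eqxx.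
Qed.

Section Subgraph.
Variables (G : graph) (S : subgraph G).

Lemma sedge_vertr x y : sedge S x y -> sverts S y.
Proof. by move=> /sedge_sym/sedge_vert. Qed.

Lemma val_sverts (x : graph_of_subgraph S) : sverts S (val x).
Proof. by case: x => x /= /set_mem. Qed.

Lemma lift_sverts (I : Type) (c : I -> G) : (forall i, sverts S (c i)) ->
  exists d : I -> graph_of_subgraph S, forall i, val (d i) = c i.
Proof. by move=> cS; exists (fun i => exist _ (c i) (mem_set (cS i))). Qed.

Lemma connectedP : connected (graph_of_subgraph S) <->
  forall a b, sverts S a -> sverts S b -> reach (sedge S) a b.
Proof.
split=> [co a b Sa Sb|co a b].
  have [n [w [w0 wn wE]]] :=
    co (exist _ a (mem_set Sa)) (exist _ b (mem_set Sb)).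
  have wr k : k <= n -> reach (sedge S) a (val (w k)).
    elim: k => [_|k IH kn]; first by rewrite w0; apply: rt_refl.
    by apply: rt_trans (IH (ltnW kn)) _; apply: rt_step; apply: wE.
  by have := wr n (leqnn n); rewrite wn.
have := geodesic (co _ _ (val_sverts a) (val_sverts b)).
move=> [n [w [w0 wn wE _ _]]].
have [d dw] : exists d : nat -> graph_of_subgraph S,
    forall i, val (d i) = w (minn i n).
  apply: (@lift_sverts nat (fun i => w (minn i n))) => i.
  case: n wn wE => [|n] wn wE; first by rewrite minn0 w0; apply: val_sverts.
  have [lin|nli] := ltnP i n.+1.
    exact: sedge_vert (wE i lin).
  by rewrite wn; exact: val_sverts.
exists n, d; split=> [||i lin]; first by apply: val_inj; rewrite dw min0n.
  by apply: val_inj; rewrite dw minnn.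
rewrite /adj /= !dw (minn_idPl (ltnW lin)) (minn_idPl lin); exact: wE.
Qed.

(** Deleting an edge [st] of an acyclic graph separates [s] from [t], and the
    side of [s] is the required cut; conversely, a cut met by a cycle in one
    edge is met in a second one. *)
Lemma acyclicP : acyclic (graph_of_subgraph S) <-> forest (sedge S).
Proof.
split=> [ac s t|fo n c [n3 cinj cE]].
  pose E a b := sedge S a b /\ ~~ edge_of s t a b.
  have edgeC a b : edge_of s t a b = edge_of s t b a.
    by apply/asboolP/asboolP => -[[-> ->]|[-> ->]]; auto.
  have Esym a b : E a b -> E b a.
    by case=> Sab; rewrite edgeC; split=> //; apply: sedge_sym.
  have [st|nst] := pselect (sedge S s t); last first.
    exists (fun=> false) => a b ab; apply/esym/negbTE/asboolP.
    by case=> -[ea eb]; apply: nst; rewrite -ea -eb //; apply: sedge_sym.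
  have bridge : ~ reach E s t.
    move=> sEt; have [n [w [w0 wn wE winj _]]] := geodesic sEt.
    have n2 : 2 <= n.
      case: n w0 wn wE {winj} => [|[|//]] w0 wn wE.
        by move: st; rewrite -w0 -wn => /sedge_adj/adj_irrefl.
      by have [_ /asboolP[]] := wE 0 isT; rewrite w0 wn; left.
    have wS i : i <= n -> sverts S (w i).
      case: i => [_|i lin]; first by rewrite w0; apply: sedge_vert st.
      by apply: sedge_vertr (proj1 (wE i lin)).
    have [d dw] : exists d : 'I_n.+1 -> graph_of_subgraph S,
      forall i, val (d i) = w i by apply: lift_sverts => i; apply: wS; rewrite -ltnS.
    apply: (ac n.+1 d); split; first by lia.
      move=> i j /(congr1 val); rewrite !dw => wij; apply: val_inj => /=.
      have := ltn_ord i; have := ltn_ord j; case: (ltngtP i j) => // ij jn i_n.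
        by case: (winj i j); first by lia.
      by case: (winj j i); first by lia.
    move=> i; rewrite /adj /= !dw val_ordS; case: eqP => [[->]|ne].
      by rewrite wn w0; apply: sedge_sym.
    by apply: (proj1 (wE i _)); have := ltn_ord i; lia.
  exists (fun a => `[< reach E s a >]) => a b ab.
  have [/asboolP e|nab] := boolP (edge_of s t a b); last first.
    suff -> : `[< reach E s a >] = `[< reach E s b >] by rewrite addbb.
    apply: asbool_equiv_eq; split=> sx; apply: rt_trans sx _; apply: rt_step.
      by split.
    by apply: Esym; split.
  have ss : `[< reach E s s >] = true by apply/asboolP; apply: rt_refl.
  have ts : `[< reach E s t >] = false by apply/negbTE/asboolP.
  by case: e => -[-> ->]; rewrite ss ts.
have n0 : 0 < n by lia.
pose i : 'I_n := Ordinal n0.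
have [f fE] := fo (val (c i)) (val (c (ordS i))).
have := fE _ _ (cE i); rewrite [X in _ = X]asboolT; last by left.
suff -> : f (val (c i)) = f (val (c (ordS i))) by rewrite addbb.
have inv : f (val (c i)) <-> f (val (c (ordS i))).
  apply: (@cycle_invariant n (fun j => f (val (c j)))) => j ji.
  have := fE _ _ (cE j).
  have cvinj : injective (val \o c) by move=> x y /= /val_inj/cinj.
  rewrite (negbTE (@cycle_edge_neq _ _ (val \o c) _ _ n3 cvinj ji)).
  by do 2 case: (f _).
by apply/idP/idP; case: inv.
Qed.

End Subgraph.

(** * Acyclic region representations force chordal balls *)

Lemma edge_of_outside (T : Type) (A : set T) (s t a b : T) :
  A a -> A b -> ~~ (`[< A s >] && `[< A t >]) -> ~~ edge_of s t a b.
Proof.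
move=> Aa Ab /negP nst; apply/asboolP => -[[ea eb]|[ea eb]]; apply: nst;
  by rewrite -ea -eb; apply/andP; split; apply/asboolP.
Qed.

Lemma cut_constant (T : Type) (E : T -> T -> Prop) (f : T -> bool) a b :
  (forall x y, E x y -> f x (+) f y = false) -> reach E a b -> f a = f b.
Proof.
move=> fE; elim=> [x y /fE||x y z _ -> _ ->] //.
by case: (f x) (f y) => [] [].
Qed.

Lemma enumerated_card_le (T : Type) (X : set T) (g : nat -> T) r :
  (forall u, X u -> exists2 k, k < r & g k = u) -> X #<= `I_r.
Proof.
move=> Xg; apply: card_le_trans (card_image_le g `I_r).
by apply: subset_card_le => u /Xg[k kr <-]; exists k.
Qed.

Section RegionsToBalls.
Variables (G H : graph) (r : nat) (R : G -> subgraph H).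
Hypotheses (Rrep : region_representation R) (Rac : r_acyclic r R).

Let Rconn v a b : sverts (R v) a -> sverts (R v) b -> reach (sedge (R v)) a b.
Proof. by have [_ /connectedP] := Rrep.1 v; apply. Qed.

Let meet u v h : u <> v -> sverts (R u) h -> sverts (R v) h -> adj u v.
Proof. by move=> uv uh vh; apply/(Rrep.2 u v uv); exists h. Qed.

Let adj_meet u v : adj u v -> exists h, sverts (R u) h /\ sverts (R v) h.
Proof.
move=> uv; have uv' : u <> v by move=> e; move: uv; rewrite e => /adj_irrefl.
by have [h [uh vh]] := (Rrep.2 u v uv').1 uv; exists h.
Qed.

Let Rforest (X : set G) : X #<= `I_r -> forest (sedge (union_subgraph X R)).
Proof. by move=> /Rac/acyclicP. Qed.

Let walk_union (X : set G) (w : nat -> G) n a b :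
  (forall k, k <= n -> X (w k)) -> (forall k, k < n -> adj (w k) (w k.+1)) ->
  sverts (R (w 0)) a -> sverts (R (w n)) b ->
  reach (sedge (union_subgraph X R)) a b.
Proof.
have inX k a' b' : X (w k) -> sverts (R (w k)) a' -> sverts (R (w k)) b' ->
    reach (sedge (union_subgraph X R)) a' b'.
  move=> Xk ak bk; apply: reach_mono (Rconn ak bk) => x y xy.
  by exists (w k).
elim: n b => [|n IH] b wX wE a0 bn; first by apply: inX a0 bn; apply: wX.
have [h [hn hSn]] := adj_meet (wE n (leqnn _)).
apply: rt_trans (inX n.+1 _ _ (wX _ _) hSn bn) => //.
apply: IH => // k kn; [apply: wX|apply: wE]; lia.
Qed.

(** The closed walk running down a geodesic from [y] to [v], up one to [z], and
    back through [x] has at most [r] vertices, so its regions form a tree.  The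
    region of [x] meets those of the two geodesics in [R y] and [R z] only.  If
    these were disjoint, a path between them in [R x] and one through the
    regions of the geodesics would close a cycle. *)
Lemma down_neighbours_adj (v x y z : G) l :
  is_dist v x l.+1 -> is_dist v y l -> is_dist v z l ->
  adj x y -> adj x z -> y <> z -> l.+1.*2 <= r -> adj y z.
Proof.
move=> [_ xmin] [[w1 [w10 w1l w1E]] _] [[w2 [w20 w2l w2E]] _] xy xz yz lr.
have low (w : nat -> G) k : w 0 = v -> (forall i, i < l -> adj (w i) (w i.+1)) ->
    k <= l -> x <> w k /\ (adj x (w k) -> k = l).
  move=> w0 wE kl; split=> [xk|/adj_sym kx].
    suff: l.+1 <= k by lia.
    by apply: xmin; exists w; split=> // i ik; apply: wE; lia.
  suff: l.+1 <= k.+1 by lia.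
  apply: xmin; exists (fun i => if i <= k then w i else x).
  split=> [//||i ik]; first by rewrite ltnn.
  rewrite -ltnS ik; case: ltnP => ki; first by apply: wE; lia.
  by have -> : i = k by lia.
apply: contrapT => nyz.
have disj h : sverts (R y) h -> ~ sverts (R z) h.
  by move=> hy hz; apply: nyz; apply: meet hy hz.
have [p [px py]] := adj_meet xy; have [q [qx qz]] := adj_meet xz.
have nqy : ~ sverts (R y) q by move=> qy; apply: (disj q).
(* The edge at which a walk from [p] to [q] in [R x] leaves [R y] for good. *)
have [s [t [st sy nty tq]]] := last_exit (Rconn px qx) py nqy.
pose Y : set G := [set u | exists2 k, k <= l & w1 k = u \/ w2 k = u].
pose X := Y `|` [set x].
have cX : X #<= `I_r.
  apply: (@enumerated_card_le _ _ (fun k => if k <= l then w1 k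
    else if k <= l + l then w2 (k - l) else x)) => u.
  case=> [[k kl [<-|<-]]|->].
  - by exists k; [lia|rewrite kl].
  - case: (posnP k) => [->|k0]; first by exists 0; [lia|rewrite /= w10 w20].
    exists (l + k); first by lia.
    by rewrite leqNgt -{1}(addn0 l) ltn_add2l k0 leq_add2l kl addKn.
  - by exists (l + l).+1; [lia|rewrite ltnn ltnNge leq_addr].
have [f fE] := Rforest cX s t.
have sq : reach (sedge (union_subgraph Y R)) s q.
  have [b bv] := (Rrep.1 v).1.
  apply: (@rt_trans _ _ _ b).
    apply: reach_sym; first exact: sedge_sym.
    apply: (@walk_union _ w1 l) => //; rewrite ?w10 ?w1l //.
    by move=> k kl; exists k => //; left.
  apply: (@walk_union _ w2 l) => //; rewrite ?w20 ?w2l //.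
  by move=> k kl; exists k => //; right.
have fsq : f s = f q.
  apply: cut_constant sq => a b [u [k kl ku] uab].
  rewrite fE; last by exists u => //; left; exists k.
  apply/negbTE/(edge_of_outside (sedge_vert uab) (sedge_vertr uab)).
  apply/negP => /andP[/asboolP us /asboolP ut].
  have xt := sedge_vertr st.
  case: ku us ut => [<-|<-] us ut.
    have [xk kl'] := low w1 k w10 w1E kl.
    have {}kl' := kl' (meet xk xt ut).
    by apply: nty; move: ut; rewrite kl' w1l.
  have [xk kl'] := low w2 k w20 w2E kl.
  have {}kl' := kl' (meet xk xt ut).
  by apply: (disj _ sy); move: us; rewrite kl' w2l.
have ftq : f t = f q.
  apply: cut_constant tq => a b [ab na nb].
  rewrite fE; last by exists x => //; right.
  by apply/asboolP => -[[ea eb]|[ea eb]]; [apply: na|apply: nb]; rewrite ?ea ?eb.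
have : f s (+) f t = edge_of s t s t by apply: fE; exists x => //; right.
by rewrite fsq ftq addbb [X in _ = X]asboolT //; left.
Qed.

(** For an edge [st] of the region of one vertex of the cycle, each geodesic
    from the centre carries a cut of its regions at [st], normalised at the
    centre.  The geodesics to the ends of an edge of the ball involve at most
    [r] vertices together, so that the cuts agree where the regions of the ends
    meet.  As [st] can be chosen off the regions of all other vertices of the
    cycle, following these cuts around the cycle shows that [s] and [t] lie on
    the same side. *)
Lemma cycle_chord_of_walks (v : G) n (c : 'I_n -> G) (l : 'I_n -> nat) :
  4 <= n -> injective c -> (forall i, adj (c i) (c (ordS i))) ->
  (forall i, walk v (c i) (l i)) -> (forall i, l i + l (ordS i) < r) ->
  exists i j, [/\ j != ordS i, i != ordS j & adj (c i) (c j)].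
Proof.
move=> n4 cinj cE cl lr; apply: contrapT => nochord.
have n3 : 2 < n := ltnW n4.
have near i j h : sverts (R (c i)) h -> sverts (R (c j)) h ->
    [\/ i = j, j = ordS i | i = ordS j].
  have [->|ij] := eqVneq i j; first by constructor 1.
  have [->|jSi] := eqVneq j (ordS i); first by constructor 2.
  have [->|iSj] := eqVneq i (ordS j); first by constructor 3.
  move=> ih jh; case: nochord; exists i, j; split=> //.
  by apply: meet ih jh => /cinj; apply/eqP.
have [w wP] := choice cl.
have [p pP] := choice (fun i => adj_meet (cE i)).
pose i0 : 'I_n := Ordinal (leq_trans (isT : 0 < 4) n4).
pose i1 := ordS i0; pose i2 := ordS i1.
(* An edge at which a walk in the region of [c i1] from that of [c i0] to that of
   [c i2] leaves the region of [c i0] for good. *)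
have [s [t [st s0 nt0 tp]]] : exists s t, [/\ sedge (R (c i1)) s t,
    sverts (R (c i0)) s, ~ sverts (R (c i0)) t &
    reach (fun x y => [/\ sedge (R (c i1)) x y, ~ sverts (R (c i0)) x
                        & ~ sverts (R (c i0)) y]) t (p i1)].
  apply: (last_exit (a := p i0)); [|exact: (pP i0).1|].
    by apply: Rconn; [exact: (pP i0).2|exact: (pP i1).1].
  move=> /near/(_ (pP i1).2)[/eqP|/eqP|/eqP].
  - by rewrite eq_sym (negbTE (ordS2_neq i0 n3)).
  - by rewrite (negbTE (ordS_neq i1 (ltnW n3))).
  - by rewrite eq_sym (negbTE (ordS3_neq i0 n4)).
(* On a cycle of length at least 4, only [i0] and [i1] are within distance 1 of
   both [i0] and [i1]; and [t] avoids the region of [c i0]. *)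
have off i : i != i1 -> ~~ (`[< sverts (R (c i)) s >] && `[< sverts (R (c i)) t >]).
  move=> ii1; apply/negP => /andP[/asboolP si /asboolP ti].
  have ni0 : i <> i0 by move=> e; apply: nt0; rewrite -e.
  have e0 : i0 = ordS i.
    by case: (near _ _ _ si s0) => // e; rewrite e eqxx in ii1.
  case: (near _ _ _ ti (sedge_vertr st)) => e.
  - by rewrite e eqxx in ii1.
  - by apply: ni0; apply/esym/ordS_inj.
  - by move: (ordS3_neq i0 n4); rewrite -/i1 -e -e0 eqxx.
have [b bv] := (Rrep.1 v).1.
pose X i : set G := [set u | exists2 k, k <= l i & w i k = u].
have XS i : X i `|` X (ordS i) #<= `I_r.
  apply: (@enumerated_card_le _ _ (fun k => if k <= l i then w i k
                                     else w (ordS i) (k - l i))) => u.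
  have [w0 _ _] := wP i; have [w0' _ _] := wP (ordS i); have := lr i.
  move=> lr' [[k kl <-]|[k kl <-]]; first by exists k; [lia|rewrite kl].
  case: (posnP k) => [->|k0]; first by exists 0; [lia|rewrite /= w0 w0'].
  exists (l i + k); first by lia.
  by rewrite leqNgt -{1}(addn0 (l i)) ltn_add2l k0 addKn.
have toX i h : sverts (R (c i)) h -> reach (sedge (union_subgraph (X i) R)) b h.
  have [w0 wl wE] := wP i => hi.
  apply: (@walk_union (X i) (w i) (l i)); rewrite ?w0 ?wl //.
  by move=> k kl; exists k.
have cut i : exists f : H -> bool, f b = false /\ forall x y,
    sedge (union_subgraph (X i) R) x y -> f x (+) f y = edge_of s t x y.
  have sub x y : sedge (union_subgraph (X i) R) x y ->
      sedge (union_subgraph (X i `|` X (ordS i)) R) x y.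
    by case=> u Xu uxy; exists u => //; left.
  have [f fE] := forest_sub sub (Rforest (XS i)) s t.
  exists (fun x => f x (+) f b); split=> [|x y xy]; first by rewrite addbb.
  by rewrite -fE // addbACA addbb addbF.
have [f fP] := choice cut.
have agree i h : sverts (R (c i)) h -> sverts (R (c (ordS i))) h ->
    f i h = f (ordS i) h.
  move=> hi hSi; have [g gE] := Rforest (XS i) s t.
  have same j : X j `<=` X i `|` X (ordS i) -> sverts (R (c j)) h ->
      f j h = g h (+) g b.
    move=> Xj hj; have [fb fE] := fP j.
    have : f j b (+) g b = f j h (+) g h.
      apply: (@cut_constant _ _ (fun x => f j x (+) g x) _ _ _ (toX j h hj)).
      move=> x y xy; rewrite addbACA fE // gE ?addbb //.
      by case: xy => u Xu uxy; exists u => //; apply: Xj.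
    by rewrite fb; case: (f j h) (g h) (g b) => [] [] [].
  have iX : X i `<=` X i `|` X (ordS i) by move=> u Xu; left.
  have SiX : X (ordS i) `<=` X i `|` X (ordS i) by move=> u Xu; right.
  by rewrite (same i iX hi) (same (ordS i) SiX hSi).
have inX i x y : sedge (R (c i)) x y -> sedge (union_subgraph (X i) R) x y.
  by have [_ wl _] := wP i; exists (c i) => //; exists (l i).
have flat i x y : i != i1 -> sverts (R (c i)) x -> sverts (R (c i)) y ->
    f i x = f i y.
  move=> ii1 xi yi; apply: cut_constant (Rconn xi yi) => a a' aa'.
  have [_ ->] := fP i; last exact: inX.
  by apply/negbTE/(edge_of_outside (sedge_vert aa') (sedge_vertr aa') (off i ii1)).
have i01 : i0 != i1 by rewrite eq_sym ordS_neq // ltnW.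
(* The way around the cycle that avoids the region of [c i1]. *)
have round : f i0 (p i0) <-> f i1 (p i1).
  apply: (@cycle_invariant n (fun i => f i (p i))) => j j0.
  have [pj pSj] := pP j; have [pSj' _] := pP (ordS j).
  rewrite (agree j) // (flat (ordS j) _ (p (ordS j))) //.
  by apply: contra j0 => /eqP/ordS_inj->.
have fs : f i1 s = f i0 (p i0).
  by rewrite -(agree i0) //; [apply: flat (pP i0).1|apply: sedge_vert st].
have ft : f i1 t = f i1 (p i1).
  apply: cut_constant tp => x y [xy nx ny]; have [_ ->] := fP i1; last exact: inX.
  by apply/asboolP => -[[ea eb]|[ea eb]]; [apply: nx|apply: ny]; rewrite ?ea ?eb.
have [_ fE] := fP i1; have : f i1 s (+) f i1 t = edge_of s t s t.
  by apply: fE; apply: inX.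
rewrite [X in _ = X]asboolT; last by left.
rewrite fs ft; have -> : f i0 (p i0) = f i1 (p i1) by apply/idP/idP; case: round.
by rewrite addbb.
Qed.

(** An edge of the ball has an end at distance less than [r / 2].  A vertex of
    a cycle at distance exactly [r / 2] has both its neighbours one level lower,
    and these are adjacent.  So on a chordless cycle all vertices are at
    distance less than [r / 2], where the ball is an induced subgraph. *)
Lemma regions_locally_chordal : locally_chordal G r.
Proof.
move=> v n c n4 [_ cinj cE]; apply: contrapT => nochord.
have n3 : 2 < n := ltnW n4.
have dist i : exists k, is_dist v (val (c i)) k /\ k.*2 <= r.
  by have [k vk kr] := val_sverts (c i); exists k.
have [l lP] := choice dist.
have dist_uniq x k k' : is_dist v x k -> is_dist v x k' -> k = k'.
  move=> [wk kmin] [wk' kmin']; apply/eqP.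
  by rewrite eqn_leq kmin // kmin'.
have cadj i : adj (val (c i)) (val (c (ordS i))) by case: (cE i).
have lr i : l i + l (ordS i) < r.
  have [_ [k [k' [vk vk' kr]]]] := cE i.
  by rewrite (dist_uniq _ _ _ (lP i).1 vk) (dist_uniq _ _ _ (lP _).1 vk').
have chord i j : j != ordS i -> i != ordS j -> l i + l j < r ->
    ~ adj (val (c i)) (val (c j)).
  move=> ji ij lij ad; apply: nochord; exists i, j; split=> //.
  by split=> //; exists (l i), (l j); split=> //; [exact: (lP i).1|exact: (lP j).1].
have low i : (l i).*2 < r.
  rewrite ltn_neqAle (lP i).2 andbT; apply/eqP => li.
  pose j := ord_pred i; have ji : ordS j = i by rewrite /j ord_predK.
  have [vi vj vk] := And3 (lP i).1 (lP j).1 (lP (ordS i)).1.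
  have aj : adj (val (c j)) (val (c i)) by have := cadj j; rewrite ji.
  have := lr i; have := lr j; rewrite ji => lji lik.
  have lj : l i = (l j).+1 by have := is_dist_adj vj vi aj; lia.
  have lk : l i = (l (ordS i)).+1.
    by have := is_dist_adj vk vi (adj_sym (cadj i)); lia.
  have lk' : l (ordS i) = l j by lia.
  rewrite lj in vi; rewrite lk' in vk.
  apply: (@chord j (ordS i)); rewrite ?ji.
  - by rewrite ordS_neq // ltnW.
  - by rewrite -ji eq_sym ordS3_neq.
  - lia.
  - apply: (down_neighbours_adj vi vj vk) => //; [exact: adj_sym| |by rewrite -lj li].
    by move=> /val_inj/cinj e; move: (ordS2_neq j n3); rewrite ji -e eqxx.
have [||||i [j [ji ij ad]]] := @cycle_chord_of_walks v n (val \o c) l n4.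
- by move=> i j /val_inj/cinj.
- exact: cadj.
- by move=> i; have [[]] := lP i.
- exact: lr.
by apply: (chord i j) => //; have := low i; have := low j; lia.
Qed.

End RegionsToBalls.

(** * Chordality in neighbourhoods *)

Definition set_size (T : Type) (A : set T) : nat :=
  #|` fset_set (A : set {classic T})|%fset.

Lemma set_size_le (T : Type) (A B : set T) :
  finite_set B -> A `<=` B -> set_size A <= set_size B.
Proof.
move=> fB AB; have fA := sub_finite_set AB fB.
have e := @fset_set_sub {classic T} A B fA fB.
by move: AB; rewrite e; apply: fsubset_leq_card.
Qed.

Lemma set_size_lt (T : Type) (A B : set T) b :
  finite_set B -> A `<=` B -> B b -> ~ A b -> set_size A < set_size B.
Proof.
move=> fB AB Bb nAb; have fA := sub_finite_set AB fB.
have e := @fset_set_sub {classic T} A B fA fB.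
have e' := @fset_set_sub {classic T} B A fB fA.
apply: fproper_ltn_card; rewrite fproperE; apply/andP; split.
  by move: AB; rewrite e.
by apply/negP => BA; apply: nAb; move: b Bb; rewrite -/(B `<=` A) e'.
Qed.

Section Chordality.
Variable G : graph.
Implicit Types (A S Z : set G).

Definition closed_nbhd (x : G) : set G := [set y | y = x \/ adj x y].

Definition common_nbhd S : set G := [set a | forall x, S x -> adj x a].

Definition chordal_on Z : Prop := forall n (c : 'I_n -> G),
  4 <= n -> is_cycle c -> (forall i, Z (c i)) -> has_chord c.

Definition linked A (a b : G) : Prop :=
  reach (fun u v => [/\ A u, A v & adj u v]) a b.

Lemma chordal_on_sub Z Z' : Z `<=` Z' -> chordal_on Z' -> chordal_on Z.
Proof. by move=> ZZ' ch n c n4 cc cZ; apply: ch => // i; apply/ZZ'/cZ. Qed.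

Lemma linked_mono A B a b : A `<=` B -> linked A a b -> linked B a b.
Proof. by move=> AB; apply: reach_mono => x y [/AB ? /AB ? ?]. Qed.

Lemma linked_sym A a b : linked A a b -> linked A b a.
Proof. by apply: reach_sym => x y [? ? /adj_sym]. Qed.

Lemma linked_adj A a b : A a -> A b -> a = b \/ adj a b -> linked A a b.
Proof. by move=> Aa Ab [->|ab]; [apply: rt_refl|apply: rt_step]. Qed.

Lemma linked_walk A (w : nat -> G) n : (forall i, i <= n -> A (w i)) ->
  (forall i, i < n -> adj (w i) (w i.+1)) -> linked A (w 0) (w n).
Proof.
elim: n => [|n IH] wA wE; first exact: rt_refl.
apply: rt_trans (IH _ _) _ => [i ile|i iln|]; [apply: wA; lia|apply: wE; lia|].
by apply: rt_step; split; [apply: wA|apply: wA|apply: wE].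
Qed.

Definition induced_path A (w : nat -> G) n : Prop :=
  [/\ forall i, i <= n -> A (w i), forall i, i < n -> adj (w i) (w i.+1),
      forall i j, i < j <= n -> w i <> w j
    & forall i j, i.+1 < j <= n -> ~ adj (w i) (w j)].

Lemma linked_induced_path A a b : A a -> linked A a b ->
  exists n w, [/\ w 0 = a, w n = b & induced_path A w n].
Proof.
move=> Aa ab; have [n [w [w0 wn wE winj wind]]] := geodesic ab.
have wA i : i <= n -> A (w i).
  by case: i => [_|i lin]; [rewrite w0|have [] := wE i lin].
exists n, w; split=> //; split=> // [i /wE[]//|i j ij wij].
by apply: (wind i j ij); split=> //; apply: wA; lia.
Qed.

(** A vertex [b] adjacent to both ends of an induced path closes it up to a
    cycle, of which every chord is at [b]; so each chord cuts off shorter paths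
    of the same kind. *)
Lemma induced_path_fan Z b (w : nat -> G) n :
  chordal_on Z -> induced_path Z w n -> Z b -> (forall i, i <= n -> b <> w i) ->
  adj b (w 0) -> adj b (w n) -> forall i, i <= n -> adj b (w i).
Proof.
move=> ch; have [m] := ubnP n; elim: m n w => // m IH n w nm.
move=> [wZ wE winj wind] Zb bw b0 bn.
have [n1|n2] := leqP n 1.
  by case: n n1 wZ wE winj wind bw bn {nm} => [|[|//]] _ _ _ _ _ _ bn [|[|]].
pose c (i : 'I_n.+2) := if i <= n then w i else b.
have cyc : is_cycle c.
  split=> [||i]; first by lia.
    move=> i j; rewrite /c; have := ltn_ord i; have := ltn_ord j.
    move=> jn i_n; case: leqP => ile; case: leqP => jle e; apply: val_inj => /=.
    - case: (ltngtP i j) => // ij; first by case: (winj i j); first by lia.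
      by case: (winj j i); first by lia.
    - by case: (bw i).
    - by case: (bw j).
    - by lia.
  have i_n := ltn_ord i; rewrite /c val_ordS.
  have [iln|iln|iln] := ltngtP i n.
  - have -> : ((nat_of_ord i).+1 == n.+2) = false by lia.
    by rewrite iln; apply: wE.
  - have -> : ((nat_of_ord i).+1 == n.+2) = true by lia.
    by [].
  - have -> : ((nat_of_ord i).+1 == n.+2) = false by lia.
    by rewrite iln ltnn; apply: adj_sym.
have [i [j [ji ij ad]]] : has_chord c.
  by apply: ch => // i; rewrite /c; case: leqP => // ile; apply: wZ.
suff [k /andP[k0 kn] bk] : exists2 k, 0 < k < n & adj b (w k).
  move=> h hn; have [hk|kh] := leqP h k.
    apply: (IH k w) => //; [lia| |by move=> h' h'k; apply: bw; lia].
    split=> [h' ?|h' ?|h' h2 ?|h' h2 ?];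
      [apply: wZ|apply: wE|apply: winj|apply: wind]; lia.
  have := IH (n - k) (fun i => w (i + k)).
  rewrite add0n subnK; last by lia.
  move=> IH'; have -> : h = h - k + k by lia.
  apply: (IH') => //; [lia| |by move=> h' h'k; apply: bw; lia|lia].
  split=> [h' ?|h' ?|h' h2 ?|h' h2 ?];
    [apply: wZ|rewrite addSn; apply: wE|apply: winj|apply: wind]; lia.
move: ji ij ad; rewrite -!(inj_eq val_inj) !val_ordS /c => ji ij ad.
move: (ltn_ord i) (ltn_ord j) => i_n jn.
move: ji ij ad; case: (leqP i n) => ile; case: (leqP j n) => jle ji ij ad.
- case: (ltngtP i j) => e.
  + by case: (wind i j) => //; move: ji; rewrite ifF /=; lia.
  + case: (wind j i) => //; last exact: adj_sym.
    by move: ij; rewrite ifF /=; lia.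
  + by move: ad; rewrite e => /adj_irrefl.
- exists i; last exact: adj_sym.
  by move: ji ij; do 2 case: ifP => /=; lia.
- exists j => //.
  by move: ji ij; do 2 case: ifP => /=; lia.
- by move: ad => /adj_irrefl.
Qed.

(** An induced path avoiding [S] inside the neighbourhood of a vertex of [S] is
    complete to [S] as soon as its ends are, by [induced_path_fan]. *)
Lemma linked_common_nbhd S x a b :
  chordal_on (closed_nbhd x) -> clique S -> S x ->
  common_nbhd S a -> common_nbhd S b ->
  linked (closed_nbhd x `\` S) a b -> linked (common_nbhd S) a b.
Proof.
move=> ch cS Sx Na Nb ab.
have Aa : (closed_nbhd x `\` S) a.
  by split; [right; apply: Na|move=> /Na/adj_irrefl].
have [n [w [w0 wn wind]]] := linked_induced_path Aa ab.
have [wA wE winj wchord] := wind.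
rewrite -w0 -wn; apply: linked_walk => // i ile s Ss.
apply: (@induced_path_fan (closed_nbhd x) s w n) => //; rewrite ?w0 ?wn.
- by split=> // j /wA[].
- have [->|sx] := pselect (s = x); [by left|right].
  by apply: cS => // /esym.
- by move=> j /wA[_ nS] e; apply: nS; rewrite -e.
- exact: Na.
- exact: Nb.
Qed.

Lemma is_dist_le (v x : G) m : walk v x m -> exists2 d, is_dist v x d & d <= m.
Proof.
move=> vx; have ex : exists n, `[< walk v x n >] by exists m; apply/asboolP.
case: (ex_minnP ex) => d /asboolP vd dmin.
exists d; last by apply: dmin; apply/asboolP.
by split=> // k vk; apply: dmin; apply/asboolP.
Qed.

Lemma ball_chord r v n (c : 'I_n -> G) :
  locally_chordal G r -> 4 <= n -> is_cycle c ->
  (forall i, sverts (ball r v) (c i)) ->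
  (forall i, sedge (ball r v) (c i) (c (ordS i))) -> has_chord c.
Proof.
move=> lc n4 [_ cinj cE] cB cBE; have [d dc] := lift_sverts cB.
have [] := lc v n d n4.
  split; [exact: ltnW|by move=> i j /(congr1 val); rewrite !dc => /cinj|].
  by move=> i; move: (cBE i); rewrite -!dc.
move=> i [j [ji ij ad]]; exists i, j; split=> //.
by move: ad; rewrite /adj /= !dc => -[].
Qed.

Lemma nbhd_chordal r x : 3 <= r -> locally_chordal G r ->
  chordal_on (closed_nbhd x).
Proof.
move=> r3 lc n c n4 cc cx.
have dist y : closed_nbhd x y -> exists2 i, is_dist x y i & i <= 1.
  by move=> [->|xy]; [have [|d] := @is_dist_le x x 0|have [|d] := @is_dist_le x y 1];
    [exists (fun=> x)|move=> ? ?; exists d => //; lia|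
     exists (fun i => if i is 0 then x else y); split=> // -[]|exists d].
apply: (@ball_chord r x) => // i.
  by have [d xd d1] := dist _ (cx i); exists d => //; lia.
split; first by case: cc.
have [d xd d1] := dist _ (cx i); have [d' xd' d1'] := dist _ (cx (ordS i)).
by exists d, d'; split=> //; lia.
Qed.

(** A cycle of length at most [r] lies in the ball around each of its
    vertices. *)
Lemma short_cycle_chord r n (c : 'I_n -> G) : locally_chordal G r ->
  4 <= n <= r -> is_cycle c -> has_chord c.
Proof.
move=> lc /andP[n4 nr] cc; have n0 : 0 < n by lia.
pose w k := c (Ordinal (ltn_pmod k n0)).
have wE k : adj (w k) (w k.+1).
  have [_ _] := cc; move/(_ (Ordinal (ltn_pmod k n0))).
  rewrite /w; congr adj; congr c; apply: val_inj => /=.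
  by rewrite -addn1 modnDml addn1.
have wc (i : 'I_n) : c i = w i.
  by congr c; apply: val_inj; rewrite /= modn_small.
have wcS (i : 'I_n) : c (ordS i) = w i.+1 by congr c; apply: val_inj.
have w_n : w n = w 0 by congr c; apply: val_inj; rewrite /= modnn mod0n.
have dist k : k <= n ->
    exists d, [/\ is_dist (w 0) (w k) d, d <= k & d <= n - k].
  move=> kn; have [|d vd dk] := @is_dist_le (w 0) (w k) k; first by exists w.
  exists d; split=> //; apply: vd.2; exists (fun i => w (n - i)).
  split=> [||i ik]; first by rewrite subn0.
    by congr w; lia.
  have -> : n - i = (n - i.+1).+1 by lia.
  exact: adj_sym.
apply: (@ball_chord r (w 0)) => // i; have i_n := ltn_ord i.
  by have [d [vd dk dnk]] := dist i (ltnW i_n); exists d; rewrite ?wc //; lia.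
rewrite wc wcS; split=> //.
have [d [vd dk dnk]] := dist i (ltnW i_n).
have [d' [vd' dk' dnk']] := dist i.+1 i_n.
by exists d, d'; split=> //; lia.
Qed.

End Chordality.

(** * A canonical clique in a finite connected chordal graph *)

Section Core.
Variable G : graph.
Implicit Types (A S Z : set G).

Definition simplicial Z (z : G) : Prop :=
  forall x y, Z x -> Z y -> adj z x -> adj z y -> x <> y -> adj x y.

Definition connected_on Z : Prop := forall a b, Z a -> Z b -> linked Z a b.

(** All vertices of a clique are simplicial, so a clique has to be kept as it
    is. *)
Definition prune Z : set G := [set z | Z z /\ (clique Z \/ ~ simplicial Z z)].

(** For a finite connected chordal [Z] the decreasing stages stop at a clique,
    which is their intersection; in this form it does not depend on a bound for
    the number of stages. *)
Definition core Z : set G := [set z | forall n, iter n prune Z z].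

Lemma not_cliqueP Z : ~ clique Z ->
  exists a b, [/\ Z a, Z b, a <> b & ~ adj a b].
Proof.
move=> nc; apply: contrapT => nex; apply: nc => a b Za Zb ab.
by apply: contrapT => nab; apply: nex; exists a, b.
Qed.

Lemma induced_path_gt1 Z (w : nat -> G) n : induced_path Z w n ->
  w 0 <> w n -> ~ adj (w 0) (w n) -> 1 < n.
Proof. by move=> [_ wE _ _]; case: n wE => [|[|n]] // /(_ 0 isT). Qed.

Lemma induced_path_inner Z (w : nat -> G) n i : induced_path Z w n ->
  0 < i < n -> ~ simplicial Z (w i).
Proof.
move=> [wZ wE winj wind] /andP[i0 iln] /(_ (w i.-1) (w i.+1)) si.
have wEi := wE i.-1; rewrite prednK // in wEi.
apply: (wind i.-1 i.+1); first by lia.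
apply: si; [apply: wZ; lia|apply: wZ; lia|apply: adj_sym; apply: wEi; lia|
  exact: wE|apply: winj; lia].
Qed.

(** A connected set [A] having a vertex of [Z] outside its closed
    neighbourhood, and maximal such, has a neighbourhood that is complete to
    the set [B] of these vertices, hence is a clique by chordality.  A
    simplicial vertex of [B] is then simplicial in [Z]. *)
Lemma exists_simplicial Z : finite_set Z -> Z !=set0 -> chordal_on Z ->
  exists2 z, Z z & simplicial Z z.
Proof.
have [m] := ubnP (set_size Z); elim: m Z => // m IH Z Zm fZ [z0 Zz0] ch.
have [cZ|/not_cliqueP[a [b [Za Zb ab nab]]]] := pselect (clique Z).
  by exists z0 => // x y Zx Zy _ _; apply: cZ.
pose far A := [set v | [/\ Z v, ~ A v & forall u, A u -> ~ adj u v]].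
pose good A := [/\ A `<=` Z, A !=set0, connected_on A & far A !=set0].
have ex : exists n, `[< exists2 A, good A & set_size A = n >].
  exists (set_size [set a]); apply/asboolP; exists [set a] => //; split.
  - by move=> _ ->.
  - by exists a.
  - by move=> _ _ -> ->; apply: rt_refl.
  - by exists b; split=> // [/esym|_ ->].
have bd n : `[< exists2 A, good A & set_size A = n >] -> n <= set_size Z.
  by move=> /asboolP[A [AZ _ _ _] <-]; apply: set_size_le.
case: (ex_maxnP ex bd) => _ /asboolP[A [AZ [a0 Aa0] cA [b0 fb0]] <-] Amax.
pose B := far A.
have BZ : B `<=` Z by move=> v [].
pose M := [set s | [/\ Z s, ~ A s & exists2 u, A u & adj u s]].
have MB s v : M s -> B v -> adj s v.
  move=> [Zs nAs [u Au us]] Bv; have [Zv nAv nav] := Bv.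
  apply: contrapT => nsv; suff : set_size (A `|` [set s]) <= set_size A.
    rewrite leqNgt => /negP; apply; apply: (@set_size_lt _ _ _ s) => //.
    + by apply: (sub_finite_set _ fZ) => x [/AZ|->].
    + by right.
  apply: Amax; apply/asboolP; exists (A `|` [set s]) => //; split.
  - by move=> x [/AZ|->].
  - by exists s; right.
  - have toA x : (A `|` [set s]) x -> linked (A `|` [set s]) x u.
      case=> [Ax|->]; first by apply: linked_mono (cA x u Ax Au) => y; left.
      by apply: linked_adj; [right|left|right; apply: adj_sym].
    by move=> x y /toA xu /toA /linked_sym; apply: rt_trans.
  - exists v; split=> //; first by case=> // vs; apply: (nav u Au); rewrite vs.
    by move=> x [/nav|->].
have MM s t : M s -> M t -> s <> t -> adj s t.
  move=> Ms Mt st; apply: contrapT => nst.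
  have [[Zs nAs [u Au us]] [Zt nAt [v Av vt]]] := (Ms, Mt).
  pose P := A `|` [set s; t].
  have PZ : P `<=` Z by move=> x [/AZ|[->|->]].
  have lst : linked P s t.
    apply: (@rt_trans _ _ _ u).
      by apply: linked_adj; [right; left|left|right; apply: adj_sym].
    apply: (@rt_trans _ _ _ v).
      by apply: linked_mono (cA u v Au Av) => x; left.
    by apply: linked_adj; [left|right; right|right].
  have [|n [w [w0 wn wi]]] := linked_induced_path _ lst; first by right; left.
  have n1 : 1 < n by apply: (induced_path_gt1 wi); rewrite w0 wn.
  have [wP wE winj wind] := wi.
  have Aw1 : A (w 1).
    have [//|[e|e]] := wP 1 (ltnW n1).
      by case: (winj 0 1); rewrite ?w0 ?e //; lia.
    by case: (winj 1 n); rewrite ?wn ?e //; lia.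
  have [Zb0 nAb0 nab0] := fb0.
  apply: (nab0 _ Aw1); apply: adj_sym.
  apply: (@induced_path_fan _ Z b0 w n) => //; rewrite ?w0 ?wn ?(ltnW n1) //.
  - by split=> // i /wP/PZ.
  - move=> i /wP[Awi|[e|e]] e'; first by apply: nAb0; rewrite e'.
      by have := MB _ _ Ms fb0; rewrite e' e => /adj_irrefl.
    by have := MB _ _ Mt fb0; rewrite e' e => /adj_irrefl.
  - by apply: adj_sym; apply: MB Ms fb0.
  - by apply: adj_sym; apply: MB Mt fb0.
have BltZ : set_size B < set_size Z.
  by apply: (@set_size_lt _ _ _ a0) => //; [apply: AZ|case].
have [||||z Bz sz] := IH B; [lia|exact: sub_finite_set BZ fZ|by exists b0|
  exact: chordal_on_sub BZ ch|].
have nbr x : Z x -> adj z x -> M x \/ B x.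
  move=> Zx zx; have [Zz nAz naz] := Bz.
  have nAx : ~ A x by move=> Ax; apply: (naz x Ax); apply: adj_sym.
  have [Mx|nMx] := pselect (M x); [by left|right; split=> // u Au ux].
  by apply: nMx; split=> //; exists u.
exists z; first exact: BZ.
move=> x y Zx Zy zx zy xy.
case: (nbr x Zx zx) => xMB; case: (nbr y Zy zy) => yMB.
- exact: MM.
- exact: MB.
- by apply: adj_sym; apply: MB.
- exact: sz.
Qed.

Lemma prune_sub Z : prune Z `<=` Z. Proof. by move=> z []. Qed.

Lemma prune_clique Z : clique Z -> prune Z = Z.
Proof. by move=> cZ; apply/seteqP; split=> z; [case|split=> //; left]. Qed.

Lemma prune_connected Z : connected_on Z -> connected_on (prune Z).
Proof.
move=> co a b Za Zb; have [[Za' _] [Zb' _]] := (Za, Zb).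
have [n [w [w0 wn wi]]] := linked_induced_path Za' (co a b Za' Zb').
have [wZ wE _ _] := wi.
rewrite -w0 -wn; apply: linked_walk => // i ile.
have [i0|ni0] := eqVneq i 0; first by rewrite i0 w0.
have [i_n|nin] := eqVneq i n; first by rewrite i_n wn.
split; first exact: wZ.
by right; apply: (induced_path_inner wi); lia.
Qed.

Lemma prune_nonempty Z : connected_on Z -> Z !=set0 -> prune Z !=set0.
Proof.
move=> co Z0; have [/prune_clique->//|/not_cliqueP] := pselect (clique Z).
move=> [a [b [Za Zb ab nab]]].
have [n [w [w0 wn wi]]] := linked_induced_path Za (co a b Za Zb).
have n1 : 1 < n by apply: (induced_path_gt1 wi); rewrite w0 wn.
exists (w 1); split; first by have [wZ _ _ _] := wi; apply: wZ; apply: ltnW.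
by right; apply: (induced_path_inner wi).
Qed.

Lemma core_sub Z : core Z `<=` Z. Proof. by move=> z /(_ 0). Qed.

(** Inner vertices of induced paths are not simplicial, so pruning preserves
    connectedness and never empties the set; it stops at a clique only, because
    chordal graphs have simplicial vertices. *)
Lemma core_clique Z : finite_set Z -> Z !=set0 -> chordal_on Z ->
  connected_on Z -> core Z !=set0 /\ clique (core Z).
Proof.
have [m] := ubnP (set_size Z); elim: m Z => // m IH Z Zm fZ Z0 ch co.
have [cZ|ncZ] := pselect (clique Z).
  suff -> : core Z = Z by [].
  apply/seteqP; split=> z; first exact: core_sub.
  by move=> Zz n; elim: n Z cZ Zz {IH Zm fZ Z0 ch co} => [|n IH] Z cZ Zz //;
    rewrite iterSr; apply: IH; rewrite prune_clique.
have -> : core Z = core (prune Z).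
  apply/seteqP; split=> z cz n; first by have := cz n.+1; rewrite iterSr.
  case: n => [|n]; first by apply: prune_sub; apply: (cz 0).
  by rewrite iterSr; apply: cz.
have [z Zz sz] := exists_simplicial fZ Z0 ch.
apply: IH.
- suff : set_size (prune Z) < set_size Z by lia.
  by apply: (@set_size_lt _ _ _ z) => //; [apply: prune_sub|case=> _ []].
- exact: sub_finite_set (@prune_sub Z) fZ.
- exact: prune_nonempty.
- exact: chordal_on_sub (@prune_sub Z) ch.
- exact: prune_connected.
Qed.

End Core.

(** * Cocycles on short cycles *)

Section Cocycle.
Variables (G : graph) (r : nat) (X : set G) (c : G -> G -> bool).

Definition near (x y : G) : Prop := x = y \/ adj x y.

Lemma near_sym x y : near x y -> near y x.
Proof. by case=> [->|/adj_sym]; [left|right]. Qed.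

Hypotheses (Xr : X #<= `I_r)
  (chords : forall n (d : 'I_n -> G), 4 <= n <= r -> is_cycle d -> has_chord d)
  (cxx : forall x, c x x = false)
  (csym : forall x y, near x y -> c x y = c y x)
  (ctri : forall x y z, near x y -> near y z -> near x z ->
    c x y (+) c y z = c x z).

Fixpoint lazy_walk (x : G) (s : seq G) (y : G) : Prop :=
  if s is a :: s' then [/\ near x a, X a & lazy_walk a s' y] else near x y.

Fixpoint parity (x : G) (s : seq G) (y : G) : bool :=
  if s is a :: s' then c x a (+) parity a s' y else c x y.

Lemma lazy_walk_cat x s a s' y : lazy_walk x (s ++ a :: s') y <->
  [/\ lazy_walk x s a, X a & lazy_walk a s' y].
Proof.
elim: s x => [|b s IH] x //=; split.
  by move=> [xb Xb /IH[ba Xa ay]].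
by move=> [[xb Xb ba] Xa ay]; split=> //; apply/IH.
Qed.

Lemma parity_cat x s a s' y :
  parity x (s ++ a :: s') y = parity x s a (+) parity a s' y.
Proof. by elim: s x => [|b s IH] x //=; rewrite IH addbA. Qed.

Lemma lazy_walk_rev x s y : X x -> lazy_walk x s y ->
  lazy_walk y (rev s) x /\ parity y (rev s) x = parity x s y.
Proof.
elim: s x => [|a s IH] x Xx /=.
  by move=> xy; split; [apply: near_sym|rewrite csym //; apply: near_sym].
move=> [xa Xa /(IH _ Xa)[ya par]]; rewrite rev_cons -cats1.
split; first by apply/lazy_walk_cat; split=> //; apply: near_sym.
by rewrite parity_cat par /= addbC csym //; apply: near_sym.
Qed.

Lemma split_nth (x : G) s j : j < size s ->
  exists s1 s2, [/\ s = s1 ++ nth x s j :: s2, size s1 = j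
                  & size s = (j + size s2).+1].
Proof.
move=> js; exists (take j s), (drop j.+1 s); split.
- by rewrite -drop_nth // cat_take_drop.
- by rewrite size_take js.
- by rewrite size_drop; lia.
Qed.

Lemma closed_split x s (i j : nat) : X x -> lazy_walk x s x -> i < j <= size s ->
  exists a b s1 s2, [/\ a = nth x (x :: s) i, b = nth x (x :: s) j, X a /\ X b,
    lazy_walk a s1 b /\ lazy_walk b s2 a
    & [/\ parity x s x = parity a s1 b (+) parity b s2 a,
      size s1 = (j - i).-1 & size s2 = size s - (j - i)]].
Proof.
move=> Xx xx /andP[ij js]; case: j js ij => // j js ij.
have [s1 [s2 [es sz1 sz]]] := split_nth x js; set b := nth x s j in es.
case: i ij => [|i] ij.
  move: xx; rewrite es => /lazy_walk_cat[xb Xb bx].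
  exists x, b, s1, s2; split=> //; first by rewrite /b -es.
  by rewrite parity_cat size_cat /=; split=> //; lia.
have is1 : i < size s1 by rewrite sz1.
have [s0 [s3 [es1 sz0 sz']]] := split_nth x is1; set a := nth x s1 i in es1.
have ea : a = nth x s i by rewrite es nth_cat is1.
have := xx; rewrite {1}es => /lazy_walk_cat[].
rewrite es1 => /lazy_walk_cat[xa Xa ab] Xb bx.
exists a, b, s3, (s2 ++ x :: s0); split=> //.
  by split=> //; apply/lazy_walk_cat.
split; [|lia|by rewrite size_cat /=; lia].
rewrite es es1 -catA cat_cons !parity_cat.
by case: (parity x s0 a) (parity a s3 b) (parity b s2 x) => [] [] [].
Qed.

Lemma parity_back a s b : X a -> X b -> near a b -> lazy_walk a s b ->
  lazy_walk a (rcons s b) a /\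
  parity a (rcons s b) a = parity a s b (+) c a b.
Proof.
move=> Xa Xb nab ab; rewrite -cats1; split.
  by apply/lazy_walk_cat; split=> //; apply: near_sym.
by rewrite parity_cat /= [c b a]csym //; apply: near_sym.
Qed.

Lemma lazy_walk_nth x s y i : lazy_walk x s y -> i <= size s ->
  near (nth x (x :: s) i) (nth x (rcons s y) i).
Proof.
elim: s x i => [|a s IH] x [|i] //=; first by case.
case=> _ _ /IH IH'; rewrite ltnS => ile; have := IH' i ile.
rewrite !(set_nth_default a x) // ?size_rcons //.
Qed.

Lemma lazy_walk_mem x s y i : X x -> lazy_walk x s y -> i <= size s ->
  X (nth x (x :: s) i).
Proof.
elim: s x i => [|a s IH] x [|i] //= Xx [_ Xa ay]; rewrite ltnS => ile.
by have := IH a i Xa ay ile; rewrite (set_nth_default a x).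
Qed.

(** A closed walk of odd parity and least length repeats no vertex, so it is a
    cycle with at most [r] vertices, and a chord would cut off a shorter one. *)
Lemma closed_even x s : X x -> lazy_walk x s x -> parity x s x = false.
Proof.
have [m] := ubnP (size s); elim: m x s => // m IH x s sm Xx xx.
have [uq|] := boolP (@uniq {classic G} (x :: s)); last first.
  case/(uniqPn (x : {classic G})) => i [j [ij js' eij]].
  have js : j <= size s := js'.
  have [|a [b [s1 [s2 [ea eb [Xa Xb] [ab ba] [-> sz1 sz2]]]]]] :=
    @closed_split x s i j Xx xx; first by rewrite ij.
  have eab : a = b by rewrite ea eb.
  rewrite -eab in ab ba *.
  by rewrite !IH //; lia.
case: (leqP (size s) 2) => [|s3].
  case: s {sm uq} xx => [|a [|b [|//]]] /=; first by rewrite cxx.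
    by case=> xa Xa ax _; rewrite [c a x]csym // addbb.
  case=> xa Xa [ab Xb bx] _; rewrite addbA (ctri xa ab) ?[c b x]csym ?addbb //.
  exact: near_sym.
(* From here on the walk is a cycle of length at least 4. *)
pose n := (size s).+1; pose d (i : 'I_n) := nth x (x :: s) i.
have dinj : injective d.
  move=> i j e; apply: val_inj; apply/eqP.
  rewrite -(@nth_uniq {classic G} x (x :: s)) ?(ltn_ord i) ?(ltn_ord j) //.
  exact/eqP.
have cyc : is_cycle d.
  split=> // [|i]; first by rewrite /n; lia.
  have n1 : 1 < n by rewrite /n; lia.
  have nd : near (d i) (d (ordS i)).
    have := lazy_walk_nth xx (ltn_ord i : i <= size s).
    rewrite /d val_ordS; congr near; rewrite nth_rcons.
    have := ltn_ord i; rewrite /n eqSS ltnS leq_eqVlt => /orP[/eqP->|lt].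
      by rewrite eqxx ltnn.
    by rewrite lt (ltn_eqF lt).
  by case: nd => // /dinj e; have := ordS_neq i n1; rewrite -e eqxx.
have nr : n <= r.
  suff : `I_n #<= `I_r by rewrite card_le_II.
  have inj : {in `I_n &, injective (nth x (x :: s))}.
    move=> i j /set_mem i_n /set_mem jn e; apply/eqP.
    by rewrite -(@nth_uniq {classic G} x (x :: s)) //; apply/eqP.
  have := inj_card_eq inj; rewrite card_eq_le => /andP[_ le].
  apply: card_le_trans le (card_le_trans _ Xr).
  by apply: subset_card_le => _ [i i_n <-]; apply: lazy_walk_mem xx _.
have [i [j [ji ij ad]]] : has_chord d by apply: chords; rewrite // /n; lia.
wlog lij : i j ji ij ad / i < j.
  move=> H; have [lt|gt|/val_inj e] := ltngtP i j; first exact: (H i j).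
    by apply: (H j i) => //; apply: adj_sym.
  by move: ad; rewrite e => /adj_irrefl.
have [|a [b [s1 [s2 [ea eb [Xa Xb] [ab ba] [-> sz1 sz2]]]]]] :=
  @closed_split x s i j Xx xx; first by rewrite lij -ltnS ltn_ord.
have nab : near a b by right; rewrite ea eb.
have [a1 p1] := parity_back Xa Xb nab ab.
have [b1 p2] := parity_back Xb Xa (near_sym nab) ba.
have [i_n jn] : i <= size s /\ j <= size s
  by split; rewrite -ltnS; [exact: (ltn_ord i)|exact: (ltn_ord j)].
have short : 1 < j - i < size s.
  have ji' : j <> i.+1 :> nat.
    move=> e; case/eqP: ji; apply: val_inj; rewrite val_ordS ifF //.
    by apply/eqP => [[jn']]; move: jn; rewrite e jn' ltnn.
  have ij' : ~ (nat_of_ord i = 0 /\ nat_of_ord j = size s).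
    by case=> ei ej; case/eqP: ij; apply: val_inj; rewrite val_ordS ej eqxx.
  by lia.
have := IH a _ _ Xa a1; have := IH b _ _ Xb b1.
rewrite p1 p2 !size_rcons sz1 sz2 [c b a]csym; last exact: near_sym.
move=> e1 e2; have {}e1 := e1 ltac:(lia); have {}e2 := e2 ltac:(lia).
by move: e1 e2; case: (parity a s1 b) (parity b s2 a) (c a b) => [] [] [].
Qed.

(** Summing a cocycle along walks from a fixed vertex of each component gives a
    potential. *)
Lemma cocycle_exact : exists g : G -> bool,
  forall x y, X x -> X y -> near x y -> c x y = g x (+) g y.
Proof.
have [[x0 Xx0]|X0] := pselect (X !=set0); last first.
  by exists (fun=> false) => x y Xx; case: X0; exists x.
pose comp x : set G := [set o | X o /\ exists s, lazy_walk o s x].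
have ex_root (Q : set G) : exists o, Q !=set0 -> Q o.
  have [[q Qq]|Q0] := pselect (Q !=set0); first by exists q.
  by exists x0 => /Q0.
have [root rootP] := choice ex_root.
have ex_walk x : exists s, X x ->
    X (root (comp x)) /\ lazy_walk (root (comp x)) s x.
  have [Xx|nXx] := pselect (X x); last by exists [::] => /nXx.
  have [|Xo [s os]] := rootP (comp x); last by exists s.
  by exists x; split=> //; exists [::]; left.
have [s sP] := choice ex_walk.
exists (fun x => parity (root (comp x)) (s x) x) => x y Xx Xy xy.
have sub z z' : X z -> near z z' -> comp z `<=` comp z'.
  move=> Xz zz' o [Xo [t ot]]; split=> //; exists (t ++ [:: z]).
  by apply/lazy_walk_cat.
have e : comp x = comp y.
  by apply/seteqP; split; apply: sub => //; apply: near_sym.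
have [Xo ox] := sP x Xx; have [_ oy] := sP y Xy; rewrite -e in oy *.
have [yo py] := lazy_walk_rev Xo oy.
have : parity (root (comp x)) (s x ++ x :: y :: rev (s y)) (root (comp x))
    = false.
  by apply: closed_even => //; apply/lazy_walk_cat; split.
rewrite parity_cat /= py.
by case: (c x y) (parity _ (s x) x) (parity _ _ y) => [] [] [].
Qed.

End Cocycle.

(** * Star systems of cliques *)

Lemma finite_closed_nbhd (G : graph) (x : G) :
  locally_finite G -> finite_set (closed_nbhd x).
Proof.
move=> lf; apply: (@sub_finite_set _ _ ([set x] `|` [set y | adj x y])).
  by move=> y [->|]; [left|right].
by rewrite finite_setU; split; [apply: finite_set1|apply: lf].
Qed.

Lemma clique_nbhd (G : graph) (A : set G) x : clique A -> A x ->
  A `<=` closed_nbhd x.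
Proof.
move=> cA Ax y Ay; have [->|yx] := pselect (y = x); [by left|right].
by apply: cA => // /esym.
Qed.

Lemma clique_common_nbhd (G : graph) (A S : set G) a : clique A -> S `<=` A ->
  A a -> ~ S a -> common_nbhd S a.
Proof. by move=> cA SA Aa nSa s Ss; apply: cA => //; [apply: SA|move=> e; apply: nSa; rewrite -e]. Qed.

Section StarSystem.
Variables (G K : graph) (V : K -> set G).

Program Definition label_region (v : G) : subgraph K :=
  @Subgraph K [set h | V h v] (fun h k => [/\ adj h k, V h v & V k v]) _ _ _.
Next Obligation. by move=> v h k []. Qed.
Next Obligation. by move=> v h k [/adj_sym]; split. Qed.
Next Obligation. by move=> v h k []. Qed.

(** A clique containing [S] leaves [S] into a single component of the common
    neighbourhood of [S], so for such labels the choice of [a] and [b] does not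
    matter. *)
Definition same_branch (S : set G) (h k : K) : Prop := exists a b,
  [/\ V h a /\ ~ S a, V k b /\ ~ S b & linked (common_nbhd S) a b].

(** In the star at the intersection of the two labels, [k] is the point at which
    a branch other than the central one is attached. *)
Definition satellite (h k : K) : Prop := ~ (V k `<=` V h) /\
  forall h' k', adj h' k' -> V h' `&` V k' = V h `&` V k ->
    same_branch (V h `&` V k) k' k -> h' = h /\ k' = k.

(** In a clique tree of a chordal graph, the edges whose labels intersect in [S]
    form a tree on the branches at [S].  Here this tree is required to be a star,
    so that each non-central branch is entered by a single edge, and no order of
    the edges has to be chosen to construct it. *)
Record star_system : Prop := StarSystem {
  star_clique : forall h, clique (V h);
  star_cover : forall S, clique S -> S !=set0 -> exists h, S `<=` V h;
  star_edge : forall h k, adj h k -> satellite h k \/ satellite k h;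
  star_hub : forall S, clique S -> S !=set0 ->
    exists2 o, S `<=` V o & forall h, S `<=` V h ->
      [\/ h = o, same_branch S h o |
        exists h' o', [/\ S `<=` V h', S `<=` V o', h = h' \/ same_branch S h h',
                       o = o' \/ same_branch S o o' & adj h' o']] }.

Arguments star_clique : clear implicits.

Hypotheses (lf : locally_finite G) (ss : star_system).

(** Along a walk in the common neighbourhood of [X], consecutive nodes can be
    chosen to share a vertex outside [X]; so a branch at [X] is connected by the
    induction hypothesis for larger cliques, and the star joins the branches. *)
Lemma label_connected (X : set G) h k : X !=set0 -> X `<=` V h -> X `<=` V k ->
  reach (fun a b => [/\ adj a b, X `<=` V a & X `<=` V b]) h k.
Proof.
move=> [x]; have [m] := ubnP (set_size (closed_nbhd x) - set_size X).
elim: m X h k => // m IH X h k Xm Xx Xh Xk.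
have cX : clique X by move=> a b /Xh ? /Xh ?; apply: (star_clique ss h).
have sub A : clique A -> A x -> set_size A <= set_size (closed_nbhd x).
  by move=> cA Ax; apply: set_size_le (finite_closed_nbhd x lf) (clique_nbhd cA Ax).
(* Nodes sharing a vertex outside [X] are connected by the induction hypothesis. *)
have larger a h' k' : ~ X a -> X `<=` V h' -> X `<=` V k' -> V h' a -> V k' a ->
    reach (fun a b => [/\ adj a b, X `<=` V a & X `<=` V b]) h' k'.
  move=> nXa Xh' Xk' h'a k'a; pose Y := X `|` [set a].
  have Yh' : Y `<=` V h' by move=> y [/Xh'|->].
  have Yk' : Y `<=` V k' by move=> y [/Xk'|->].
  have cY : clique Y by move=> u v /Yh' ? /Yh' ?; apply: (star_clique ss h').
  have Yx : Y x by left.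
  have XY : set_size X < set_size Y.
    apply: (@set_size_lt _ _ _ a) => //; [|by move=> y; left|by right].
    exact: sub_finite_set (clique_nbhd cY Yx) (finite_closed_nbhd x lf).
  have YN := sub _ cY Yx.
  apply: reach_mono (IH Y h' k' _ Yx Yh' Yk'); last by lia.
  by move=> u v [uv Yu Yv]; split=> // y Xy; [apply: Yu|apply: Yv]; left.
have branch h' k' : X `<=` V h' -> X `<=` V k' -> same_branch X h' k' ->
    reach (fun a b => [/\ adj a b, X `<=` V a & X `<=` V b]) h' k'.
  move=> Xh' Xk' [a [b [[h'a nXa] [k'b nXb] ab]]].
  have : common_nbhd X a by apply: clique_common_nbhd (star_clique ss h') _ _ _.
  move/(clos_rt_rt1n _ _ _ _): ab => ab; elim: ab h' Xh' h'a nXa k'b nXb.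
    by move=> u h' Xh' h'u nXu k'u _ _; apply: larger h'u k'u.
  move=> u v w [Nu Nv uv] _ IHuv h' Xh' h'u nXu k'w nXw _.
  have cY : clique (X `|` [set u; v]).
    move=> y z [Xy|[->|->]] [Xz|[->|->]] yz //; first exact: cX.
    - exact: Nu.
    - exact: Nv.
    - by apply: adj_sym; apply: Nu.
    - by apply: adj_sym; apply: Nv.
    - exact: adj_sym.
  have [|l Yl] := star_cover ss cY; first by exists x; left.
  have Xl : X `<=` V l by move=> y Xy; apply: Yl; left.
  apply: (@rt_trans _ _ _ l).
    by apply: (larger u) => //; apply: Yl; right; left.
  apply: IHuv => //; first by apply: Yl; right; right.
  by move=> /Nv/adj_irrefl.
have [|o Xo hub] := star_hub ss cX; first by exists x.
have toO h' : X `<=` V h' ->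
    reach (fun a b => [/\ adj a b, X `<=` V a & X `<=` V b]) h' o.
  move=> Xh'; case: (hub h' Xh') => [->|/branch|[l [p [Xl Xp hl op lp]]]].
  - exact: rt_refl.
  - exact.
  - apply: (@rt_trans _ _ _ l).
      by case: hl => [->|/branch]; [apply: rt_refl|apply].
    apply: (@rt_trans _ _ _ p); first by apply: rt_step.
    apply: reach_sym; first by move=> a b [/adj_sym ? ? ?].
    by case: op => [->|/branch]; [apply: rt_refl|apply].
apply: rt_trans (toO h Xh) _; apply: reach_sym; last exact: toO.
by move=> a b [/adj_sym ? ? ?].
Qed.

Hypothesis nbhd_ch : forall x : G, chordal_on (closed_nbhd x).

(** On a cycle of labels containing [x], let [S] be an intersection of two
    consecutive labels of least size, [b] the satellite end of this edge, and
    consider the component of the neighbourhood of [x] without [S] that contains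
    the rest of [b].  An edge whose labels share a vertex outside [S] does not
    leave this component.  For any other edge the labels intersect in [S], and
    by chordality it would leave the branch of [b] at [S], which only the first
    edge does. *)
Lemma label_acyclic x : acyclic (graph_of_subgraph (label_region x)).
Proof.
move=> n c [n3 cinj cE]; have n0 : 0 < n by lia.
pose d i := val (c i); have dx i : V (d i) x := val_sverts (c i).
have dE i : adj (d i) (d (ordS i)) by case: (cE i).
have dinj : injective d by move=> i j /val_inj/cinj.
have fin h (A : set G) : V h x -> A `<=` V h -> finite_set A.
  move=> hx Ah; apply: sub_finite_set (finite_closed_nbhd x lf).
  exact: subset_trans Ah (clique_nbhd (star_clique ss h) hx).
pose T i := V (d i) `&` V (d (ordS i)).
have [i Tmin] : exists i, forall j, set_size (T i) <= set_size (T j).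
  pose i0 : 'I_n := Ordinal n0.
  case: (@arg_minnP _ i0 xpredT (fun i => set_size (T i)) isT) => i _ imin.
  by exists i => j; apply: imin.
suff sep a b : edge_of (d i) (d (ordS i)) a b -> V a `&` V b = T i -> adj a b ->
    satellite a b -> False.
  case: (star_edge ss (dE i)) => [/sep|/sep]; apply; rewrite ?(setIC (V (d (ordS i)))) //.
  - by apply/asboolP; left.
  - by apply/asboolP; right.
  - exact: adj_sym.
move=> eab Tab adab [nsub uniq].
have [ax bx] : V a x /\ V b x by case/asboolP: eab => -[-> ->].
have [z [bz naz]] : exists z, V b z /\ ~ V a z.
  by apply: contrapT => nex; apply: nsub => z bz; apply: contrapT => naz; apply: nex; exists z.
pose S := V a `&` V b; have Sx : S x by [].
have nSz : ~ S z by case.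
have cS : clique S by move=> u v [au _] [av _]; apply: (star_clique ss a).
pose A := closed_nbhd x `\` S.
pose P D := exists d, [/\ V D d, ~ S d & linked A d z].
have inA D y : V D x -> V D y -> ~ S y -> A y.
  by move=> Dx Dy nSy; split=> //; apply: clique_nbhd (star_clique ss D) Dx _ Dy.
have near_in D u v : V D u -> V D v -> near u v.
  move=> Du Dv; have [->|uv] := pselect (u = v); [by left|right].
  exact: star_clique ss D u v Du Dv uv.
have Pbranch D : V D x -> S `<=` V D -> P D -> same_branch S D b.
  move=> Dx SD [e [De nSe ez]]; exists e, z; split=> //.
  have cD := (star_clique ss D); have cb := (star_clique ss b).
  apply: (linked_common_nbhd (x := x)) ez => //.
    exact: clique_common_nbhd cD SD De nSe.
  by apply: clique_common_nbhd cb _ bz nSz => y [].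
have step D D' : adj D D' -> V D x -> V D' x ->
    ~ (D' = a /\ D = b) -> set_size S <= set_size (V D `&` V D') ->
    P D -> P D'.
  move=> DD' Dx D'x nab Sle PD; have [e [De nSe ez]] := PD.
  have [[t [[Dt D't] nSt]]|TS] := pselect (exists t, (V D `&` V D') t /\ ~ S t).
    exists t; split=> //; apply: rt_trans ez.
    apply: linked_adj; [exact: (inA D)|exact: (inA D)|exact: near_in Dt De].
  have {}TS : V D `&` V D' `<=` S.
    by move=> t Tt; apply: contrapT => nSt; apply: TS; exists t.
  have ST : S `<=` V D `&` V D'.
    move=> y Sy; apply: contrapT => nTy; move: Sle; rewrite leqNgt => /negP; apply.
    by apply: (@set_size_lt _ _ _ y) => //; apply: (fin a) => // ? [].
  have e' : V D' `&` V D = S by rewrite setIC; apply/seteqP.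
  case: nab; apply: uniq => //; first exact: adj_sym.
  by apply: Pbranch => // y /ST[].
have Pb : P b by exists z; split=> //; apply: rt_refl.
have Pi : P (d i) <-> P (d (ordS i)).
  apply: (@cycle_invariant n (fun i => P (d i))) => j ji.
  have neq := cycle_edge_neq n3 dinj ji.
  have Sj : set_size S <= set_size (T j) by rewrite /S Tab.
  have [n1 n2] : ~ (d (ordS j) = a /\ d j = b) /\ ~ (d j = a /\ d (ordS j) = b).
    by split=> -[ea eb]; case/negP: neq; rewrite ea eb;
      apply/asboolP; case/asboolP: eab => -[-> ->]; auto.
  split; apply: step => //.
  - by apply: adj_sym.
  - by rewrite setIC.
have Pa : P a by case/asboolP: eab Pb => -[-> ->]; case: Pi; auto.
have [|eba _] := uniq b a (adj_sym adab) (setIC _ _).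
  by apply: Pbranch => // y [].
by move: adab; rewrite eba => /adj_irrefl.
Qed.

Variable r : nat.
Hypothesis chords : forall n (d : 'I_n -> G),
  4 <= n <= r -> is_cycle d -> has_chord d.

(** Cuts of the single regions at a given edge differ by a constant on the
    connected overlap of two regions.  These constants form a cocycle, so that
    the cuts can be adjusted to agree on all overlaps. *)
Lemma label_r_acyclic : r_acyclic r label_region.
Proof.
move=> X Xr; apply/acyclicP => s t.
have [f fE] := choice (fun x => (acyclicP (label_region x)).1 (@label_acyclic x) s t).
have overlap x y h k : V h x -> V h y -> V k x -> V k y ->
    f x h (+) f y h = f x k (+) f y k.
  move=> hx hy kx ky.
  have xyE l : V l x -> V l y -> [set x; y] `<=` V l by move=> lx ly _ [->|->].
  have hk : reach (fun a b => [/\ adj a b, [set x; y] `<=` V a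
                                & [set x; y] `<=` V b]) h k.
    by apply: label_connected; [exists x; left|apply: xyE|apply: xyE].
  apply: (reach_invariant (P := fun l => f x h (+) f y h = f x l (+) f y l)) hk _ => //.
  move=> a b [ab aX bX] ->.
  have [ax bx] := (aX x (or_introl erefl), bX x (or_introl erefl)).
  have [ay by_] := (aX y (or_intror erefl), bX y (or_intror erefl)).
  have := fE y a b (And3 ab ay by_); rewrite -(fE x a b (And3 ab ax bx)).
  by case: (f x a) (f x b) (f y a) (f y b) => [] [] [] [].
have ex_c (p : G * G) : exists b, forall h, V h p.1 -> V h p.2 ->
    f p.1 h (+) f p.2 h = b.
  have [[h [h1 h2]]|nex] := pselect (exists h, V h p.1 /\ V h p.2); last first.
    by exists false => h h1 h2; case: nex; exists h.
  by exists (f p.1 h (+) f p.2 h) => k k1 k2; apply: overlap.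
have [c0 c0E] := choice ex_c; pose c x y := c0 (x, y).
have cE x y h : V h x -> V h y -> f x h (+) f y h = c x y := @c0E (x, y) h.
have cover3 x y z : near x y -> near y z -> near x z ->
    exists h, [/\ V h x, V h y & V h z].
  move=> xy yz xz; have [||h hP] := @star_cover ss [set u | [\/ u = x, u = y | u = z]].
  - move=> u v uX vX uv; have [//|//] : near u v.
    by case: uX vX => [->|->|->] [->|->|->] //; (by left) || exact: near_sym.
  - by exists x; constructor 1.
  by exists h; split; apply: hP; [constructor 1|constructor 2|constructor 3].
have [g gE] : exists g : G -> bool,
    forall x y, X x -> X y -> near x y -> c x y = g x (+) g y.
  apply: (cocycle_exact Xr chords).
  - by move=> x; have [|||h [hx _ _]] := cover3 x x x; try (by left);
      rewrite -(cE x x h hx hx) addbb.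
  - move=> x y xy; have [||h [hx hy _]] := cover3 x y y xy; [by left|by []|].
    by rewrite -(cE x y h) // -(cE y x h) // addbC.
  - move=> x y z xy yz xz; have [h [hx hy hz]] := cover3 x y z xy yz xz.
    rewrite -(cE x y h) // -(cE y z h) // -(cE x z h) //.
    by rewrite addbA -(addbA (f x h)) addbb addbF.
have ex_F h : exists b, forall x, X x -> V h x -> f x h (+) g x = b.
  have [[x [Xx hx]]|nex] := pselect (exists x, X x /\ V h x); last first.
    by exists false => x Xx hx; case: nex; exists x.
  exists (f x h (+) g x) => y Xy hy.
  have nyx : near y x.
    have [->|yx] := pselect (y = x); [by left|right].
    exact: star_clique ss h y x hy hx yx.
  have := gE y x Xy Xx nyx; rewrite -(cE y x h) //.
  by case: (f y h) (f x h) (g x) (g y) => [] [] [] [].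
have [F FE] := choice ex_F.
exists F => a b [x Xx abx]; have [ab ax bx] := abx.
rewrite -(FE a x) // -(FE b x) // addbACA addbb addbF.
exact: fE abx.
Qed.

Lemma label_region_representation : region_representation label_region.
Proof.
split=> [v|u v uv].
  have cv : clique [set v] by move=> _ _ -> -> [].
  have [|h hv] := star_cover ss cv; first by exists v.
  split; first by exists h; apply: hv.
  apply/connectedP => a b av bv.
  apply: reach_mono (@label_connected [set v] a b _ _ _) => [k l [kl kv lv]||_ ->|_ ->] //.
    by split=> //; [apply: kv|apply: lv].
  by exists v.
split=> [ad|[h [hu hv]]]; last exact: star_clique ss h u v hu hv uv.
have cuv : clique [set u; v].
  by move=> x y [->|->] [->|->] // _; apply: adj_sym.
have [|h hP] := star_cover ss cuv; first by exists u; left.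
by exists h; split; apply: hP; [left|right].
Qed.

End StarSystem.

(** * Clique graphs from stars of branches *)

Program Definition edge_graph (G : graph) (S : subgraph G) : graph :=
  @Graph G (sedge S) _ _.
Next Obligation. by move=> G S x y; apply: sedge_sym. Qed.
Next Obligation. by move=> G S x /sedge_adj; apply: adj_irrefl. Qed.

Section Branches.
Variables (G K : graph) (V : K -> set G).
Hypothesis Vclique : forall h, clique (V h).
Implicit Types (S : set G) (h k l : K).

Lemma same_branch_sym S h k : same_branch V S h k -> same_branch V S k h.
Proof. by move=> [a [b [Ha Hb ab]]]; exists b, a; split=> //; apply: linked_sym. Qed.

Lemma same_branch_trans S h k l : S `<=` V k ->
  same_branch V S h k -> same_branch V S k l -> same_branch V S h l.
Proof.
move=> Sk [a [b [Ha [kb nSb] ab]]] [b' [d [[kb' nSb'] Hd bd]]].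
exists a, d; split=> //; apply: rt_trans ab (rt_trans _ _ _ _ _ _ bd).
apply: linked_adj; [exact: clique_common_nbhd (@Vclique k) Sk kb nSb|
  exact: clique_common_nbhd (@Vclique k) Sk kb' nSb'|].
by have [->|bb'] := pselect (b = b'); [left|right; apply: (@Vclique k)].
Qed.

Definition branch_class S h : set K :=
  [set k | S `<=` V k /\ (k = h \/ same_branch V S k h)].

Lemma branch_class_eq S h k : S `<=` V h -> branch_class S h k ->
  branch_class S k = branch_class S h.
Proof.
move=> Sh [Sk kh]; apply/seteqP; split=> l [Sl lE]; split=> //.
  case: lE kh => [->//|lk [<-|kh]]; first by right.
  by right; apply: same_branch_trans lk kh.
case: lE kh => [-> [->|kh]|lh [->|kh]]; [by left|right; exact: same_branch_sym|
  by right|right; apply: same_branch_trans lh _ => //; exact: same_branch_sym].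
Qed.

End Branches.

Section MaximalCliques.
Variable G : graph.
Let K := clique_intersection_graph G.
Let V (h : K) : set G := val h.

Lemma max_cliqueP (h : K) : max_cliques (V h).
Proof. exact: set_mem (valP h). Qed.

Lemma max_clique_clique (h : K) : clique (V h).
Proof. by case: (max_cliqueP h). Qed.

(** Zorn's lemma is applied to the sets whose union with [S] is a clique: these
    include the union of the empty chain. *)
Lemma clique_max_clique (S : set G) : clique S -> exists h : K, S `<=` V h.
Proof.
move=> cS; have [|A [cSA Amax]] := @Zorn_bigcup G [set A | clique (S `|` A)].
  move=> F FC Ftot x y.
  have mem B : F B -> (S `|` B) `<=` S `|` \bigcup_(X in F) X.
    by move=> FB z [Sz|Bz]; [left|right; exists B].
  case=> [Sx|[B FB Bx]] [Sy|[C FC' Cy]].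
  - exact: cS.
  - by apply: (FC C FC'); [left|right].
  - by apply: (FC B FB); [right|left].
  - case: (Ftot B C FB FC') => [BC|CB].
      by apply: (FC C FC'); right => //; apply: BC.
    by apply: (FC B FB); right => //; apply: CB.
have maxSA : max_cliques (S `|` A).
  split=> // B cB SAB; apply/seteqP; split=> // b Bb; right.
  apply: contrapT => nAb; apply: (Amax B); last first.
    rewrite /mkset; have -> // : S `|` B = B by apply/setUidPr => z Sz; apply: SAB; left.
  by split=> [z Az|/(_ b Bb)//]; apply: SAB; right.
by exists (exist _ (S `|` A) (mem_set maxSA)) => z Sz; left.
Qed.

Lemma max_clique_eq (h k : K) : V k `<=` V h -> h = k.
Proof.
move=> kh; apply: val_inj.
by apply: (max_cliqueP k).2 kh; apply: max_clique_clique.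
Qed.

(** The star at [S] joins chosen representatives of the branches at [S] to the
    representative of one chosen branch. *)
Lemma exists_star_clique_graph : exists H : subgraph K,
  sverts H = setT /\ star_system (K := edge_graph H) V.
Proof.
have ex_rep (Q : set K) : exists o : option K,
    if o is Some k then Q k else Q = set0.
  have [[k Qk]|Q0] := pselect (Q !=set0); first by exists (Some k).
  by exists None; apply/seteqP; split=> // k Qk; case: Q0; exists k.
have [rep repP] := choice ex_rep.
have rep_in Q k : rep Q = Some k -> Q k by move=> e; have := repP Q; rewrite e.
have rep_ex Q k : Q k -> exists l, rep Q = Some l.
  by move=> Qk; have := repP Q; case: (rep Q) => [l|Q0]; [exists l|rewrite Q0 in Qk].
pose above S : set K := [set h | S `<=` V h].
pose cls := @branch_class G K V.
have repC S h k : S `<=` V h -> rep (cls S h) = Some k ->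
    S `<=` V k /\ cls S k = cls S h.
  move=> Sh /rep_in Ck; split; first by case: Ck.
  exact: (branch_class_eq max_clique_clique Sh Ck).
have same_cls S h k : S `<=` V h -> S `<=` V k -> same_branch V S k h ->
    cls S k = cls S h.
  by move=> Sh Sk kh; apply: (branch_class_eq max_clique_clique Sh); split=> //; right.
pose E0 S a b := [/\ S !=set0, a <> b & exists o h,
  [/\ rep (above S) = Some o, S `<=` V h, rep (cls S o) = Some a
    & rep (cls S h) = Some b]].
have E0V S a b : E0 S a b -> [/\ S `<=` V a, S `<=` V b & V a `&` V b = S].
  move=> [_ ab [o [h [/rep_in So Sh ra rb]]]].
  have [Sa ea] := repC _ _ _ So ra; have [Sb eb] := repC _ _ _ Sh rb.
  split=> //; apply/seteqP; split=> [t [at_ bt]|t St]; last by split; [apply: Sa|apply: Sb].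
  apply: contrapT => nSt; apply: ab.
  have e : cls S a = cls S b.
    apply: same_cls => //; exists t, t; split=> //; exact: rt_refl.
  by have [] : Some a = Some b by rewrite -ra -rb -ea -eb e.
pose E a b := exists S, E0 S a b \/ E0 S b a.
have EK a b : E a b -> @adj K a b.
  have E0K S a' b' : E0 S a' b' -> @adj K a' b'.
    move=> e; have [_ _ eS] := E0V _ _ _ e; case: e => -[x Sx] ab _.
    by split=> //; exists x; rewrite -/(V a') -/(V b') eS.
  by case=> S [/E0K|/E0K/adj_sym].
have Esym a b : E a b -> E b a by case=> S [?|?]; exists S; [right|left].
pose H : subgraph K := @Subgraph K setT E EK Esym (fun _ _ _ => I).
exists H; split=> //.
have E0sat S a b : E0 S a b -> satellite (K := edge_graph H) V a b.
  move=> e; have [Sa Sb eS] := E0V _ _ _ e.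
  have [S0 ab [o [h [ro Sh ra rb]]]] := e.
  have So := rep_in _ _ ro.
  split=> [/max_clique_eq//|h' k'].
  have [_ ea] := repC _ _ _ So ra; have [_ eb] := repC _ _ _ Sh rb.
  move=> [S' [e'|e']]; have [Sh' Sk' eS'] := E0V _ _ _ e'; rewrite eS.
    rewrite eS' => eSS'; rewrite {}eSS' in e' Sh' Sk' *.
    case: e' => _ _ [o' [h'' [ro' Sh'' ra' rb']]] k'b.
    move: ro'; rewrite ro => -[eo]; rewrite -eo ra in ra'.
    have [_ eb'] := repC _ _ _ Sh'' rb'.
    split; first by case: ra'.
    have : Some k' = Some b; last by case.
    by rewrite -rb -rb' -eb -eb' (same_cls S b k').
  rewrite setIC eS' => eSS'; rewrite {}eSS' in e' Sh' Sk' *.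
  case: e' => _ _ [o' [h'' [ro' Sh'' ra' rb']]] k'b; case: ab.
  move: ro'; rewrite ro => -[eo]; rewrite -eo ra in ra'.
  have : Some a = Some b; last by case.
  by rewrite -ra -rb -ea -eb; case: ra' => ->; rewrite (same_cls S b k').
split.
- exact: max_clique_clique.
- by move=> S cS _; apply: clique_max_clique.
- by move=> h k [S [/E0sat|/E0sat]]; [left|right].
move=> S cS S0; have [k0 Sk0] := clique_max_clique cS.
have [o ro] := rep_ex (above S) k0 Sk0; have So := rep_in _ _ ro.
exists o => // h Sh.
have selfC l : S `<=` V l -> cls S l l by move=> Sl; split=> //; left.
have [a ra] := rep_ex _ _ (selfC o So); have [b rb] := rep_ex _ _ (selfC h Sh).
have [Sa ea] := repC _ _ _ So ra; have [Sb eb] := repC _ _ _ Sh rb.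
have [ab|ab] := pselect (a = b).
  have : cls S o h by rewrite -ea ab eb; apply: selfC.
  by case=> _ [->|]; [constructor 1|constructor 2].
constructor 3; exists b, a; split=> //.
- by have : cls S b h; [rewrite eb; apply: selfC|case=> _ [->|]; [left|right]].
- by have : cls S a o; [rewrite ea; apply: selfC|case=> _ [->|]; [left|right]].
by exists S; right; split=> //; exists o, h.
Qed.

End MaximalCliques.

(** * A canonical region representation *)

Section CanonicalGraph.
Variable G : graph.
Implicit Types (A B S Z : set G).

Definition component A (z : G) : set G := [set y | linked (common_nbhd A) z y].

Definition parent A B : Prop := A <> B /\
  exists2 z, common_nbhd A z & B = A `|` core (component A z).

Definition nonempty_cliques : set (set G) := [set A | clique A /\ A !=set0].

Program Definition core_graph : graph :=
  @Graph (set_type nonempty_cliques)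
    (fun h k => parent (val h) (val k) \/ parent (val k) (val h)) _ _.
Next Obligation. by move=> h k [|]; [right|left]. Qed.
Next Obligation. by move=> h [[]|[]]. Qed.

Definition node_label (h : core_graph) : set G := val h.

Lemma node_labelP (h : core_graph) : nonempty_cliques (node_label h).
Proof. exact: set_mem (valP h). Qed.

Lemma node_clique (h : core_graph) : clique (node_label h).
Proof. by case: (node_labelP h). Qed.

Hypotheses (lf : locally_finite G)
  (nbhd_ch : forall x : G, chordal_on (closed_nbhd x)).

Lemma component_sub A z : common_nbhd A z -> component A z `<=` common_nbhd A.
Proof.
move=> Nz y zy; apply: (reach_invariant (P := common_nbhd A) _ zy Nz).
by move=> u v [].
Qed.

Lemma component_connected A z : connected_on (component A z).
Proof.
have zy y : component A z y -> linked (component A z) z y.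
  move=> /(clos_rt_rtn1 _ _ _ _); elim=> [|u v uv zu IH]; first exact: rt_refl.
  have zu' : component A z u := clos_rtn1_rt _ _ _ _ zu.
  apply: rt_trans IH (rt_step _ _ _ _ _); split=> //; last by case: uv.
  by apply: rt_trans zu' (rt_step _ _ _ _ uv).
by move=> a b /zy/linked_sym za /zy; apply: rt_trans.
Qed.

Lemma component_core A z : A !=set0 -> common_nbhd A z ->
  core (component A z) !=set0 /\ clique (core (component A z)).
Proof.
move=> [x Ax] Nz; have sub : component A z `<=` closed_nbhd x.
  by move=> y /(component_sub Nz)/(_ x Ax); right.
apply: core_clique.
- exact: sub_finite_set sub (finite_closed_nbhd x lf).
- by exists z; apply: rt_refl.
- exact: chordal_on_sub sub (@nbhd_ch x).
- exact: component_connected.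
Qed.

(** Only [S] itself has its canonical cliques attached at [S], and the branch
    determines the component, hence the canonical clique. *)
Lemma parent_satellite h k : parent (node_label h) (node_label k) ->
  satellite node_label h k.
Proof.
move=> [hk [z Nz ek]]; have [_ h0] := node_labelP h; set S := node_label h in hk Nz ek h0 *.
have Sk : S `<=` node_label k by rewrite ek => y; left.
split=> [kS|h' k']; first by apply: hk; apply/seteqP.
have -> : S `&` node_label k = S by apply/setIidPl.
move=> hk' eS [a [b [[k'a nSa] [kb nSb] ab]]].
have [Sh' Sk'] : S `<=` node_label h' /\ S `<=` node_label k'.
  by rewrite -eS; split=> y [].
case: hk' => -[ne [z' Nz' e]]; last first.
  by case: nSa; rewrite -eS; split=> //; change (node_label h' a); rewrite [node_label h']e; left.
have eh' : node_label h' = S.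
  rewrite -eS; apply/esym/setIidPl; by rewrite [node_label k']e => y; left.
have e_h : h' = h by apply: val_inj.
split=> //; apply: val_inj; rewrite [val k']e [val k]ek -/(node_label h') eh'.
rewrite -/(node_label h') eh' in Nz' *.
have a_z' : component S z' a.
  have : node_label k' a by []; rewrite [node_label k']e -/(node_label h') eh'.
  by case=> // /core_sub.
have b_z : component S z b by move: kb; rewrite ek => -[//|/core_sub].
congr (_ `|` core _); apply/seteqP; split=> y zy.
  apply: rt_trans b_z (rt_trans _ _ _ _ _ (linked_sym ab) _).
  by apply: rt_trans (linked_sym a_z') zy.
apply: rt_trans a_z' (rt_trans _ _ _ _ _ ab _).
by apply: rt_trans (linked_sym b_z) zy.
Qed.

(** The star at [S] joins the node [S] to one node in each branch, the canonical
    clique of the branch. *)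
Lemma core_graph_star : star_system node_label.
Proof.
split.
- exact: node_clique.
- move=> S cS S0; exists (exist _ S (mem_set (conj cS S0) : S \in nonempty_cliques)) => y.
  by [].
- by move=> h k [/parent_satellite|/parent_satellite]; [left|right].
move=> S cS S0; pose o : core_graph :=
  exist _ S (mem_set (conj cS S0) : S \in nonempty_cliques).
exists o; first by [].
move=> h Sh; have [hS|nhS] := pselect (node_label h `<=` S).
  by constructor 1; apply: val_inj; apply/seteqP.
have [a [ha nSa]] : exists a, node_label h a /\ ~ S a.
  by apply: contrapT => nex; apply: nhS => a ha; apply: contrapT => nSa; apply: nex; exists a.
have Na := clique_common_nbhd (@node_clique h) Sh ha nSa.
have [[b cb] cc] := component_core S0 Na.
have Nb := component_sub Na.
pose k0 := S `|` core (component S a).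
have ck0 : nonempty_cliques k0.
  split; last by exists b; right.
  move=> x y [Sx|cx] [Sy|cy] xy; [exact: (cS x y)| | |exact: cc].
    by apply: Nb (core_sub cy) x Sx.
  by apply: adj_sym; apply: Nb (core_sub cx) y Sy.
pose k : core_graph := exist _ k0 (mem_set ck0).
have nSb : ~ S b by move=> /(Nb b (core_sub cb))/adj_irrefl.
constructor 3; exists k, o; split=> //.
- by move=> y; left.
- by right; exists a, b; split=> //; [split=> //; right|apply: core_sub cb].
- by left.
right; split; last by exists a.
by move=> e; apply: nSb; have : k0 b by [right]; rewrite -[k0]e.
Qed.

(** ** Naturality of the construction *)

Section Automorphism.
Variable f : aut G.

Let finj : injective f := bij_inj (aut_bij f).

Let fsurj y : exists x, f x = y.
Proof. by have [g _ gK] := aut_bij f; exists (g y). Qed.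

Let image_inP A x : (f @` A) (f x) <-> A x.
Proof. by split=> [[y Ay /finj<-]|]; [|exists x]. Qed.

Lemma image_aut_inj A B : f @` A = f @` B -> A = B.
Proof.
by move=> e; apply/seteqP; split=> x Ax; apply/image_inP; [rewrite -e|rewrite e];
  apply/image_inP.
Qed.

Let image_eq A B : (forall x, A (f x) <-> B x) -> A = f @` B.
Proof.
move=> AB; apply/seteqP; split=> [y|_ [x Bx <-]]; last exact/AB.
by have [x <-] := fsurj y => /AB Bx; exists x.
Qed.

Lemma clique_aut A : clique (f @` A) <-> clique A.
Proof.
split=> cA x y; last by move=> [a Aa <-] [b Bb <-] ab; apply/aut_adj/cA => // e;
  apply: ab; rewrite e.
by move=> Ax Ay xy; apply/(aut_adj f)/cA; [exists x|exists y|move/finj].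
Qed.

Lemma simplicial_aut Z z : simplicial (f @` Z) (f z) <-> simplicial Z z.
Proof.
split=> sz.
  move=> x y Zx Zy zx zy xy; apply/(aut_adj f)/sz;
    by [exists x|exists y|apply/aut_adj|apply/aut_adj|move/finj].
move=> _ _ [x Zx <-] [y Zy <-] /aut_adj zx /aut_adj zy xy.
by apply/aut_adj/sz => // e; apply: xy; rewrite e.
Qed.

Lemma prune_aut Z : prune (f @` Z) = f @` prune Z.
Proof.
apply: image_eq => x.
by split=> -[/image_inP Zx [/clique_aut cZ|nsx]]; split=> //; (by left) ||
  by right=> /simplicial_aut.
Qed.

Lemma core_aut Z : core (f @` Z) = f @` core Z.
Proof.
apply: image_eq => x; have iterE n : iter n (@prune G) (f @` Z) = f @` iter n (@prune G) Z.
  by elim: n => //= n ->; rewrite prune_aut.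
by split=> cx n; have := cx n; rewrite iterE => /image_inP.
Qed.

Lemma common_nbhd_aut A : common_nbhd (f @` A) = f @` common_nbhd A.
Proof.
apply: image_eq => x; split=> Nx y; last by move=> [a Aa <-]; apply/aut_adj/Nx.
by move=> Ay; apply/(aut_adj f)/Nx; exists y.
Qed.

Lemma linked_aut A x y : linked (f @` A) (f x) (f y) <-> linked A x y.
Proof.
split=> [xy|].
  suff H u v : linked (f @` A) u v -> forall a b, u = f a -> v = f b -> linked A a b.
    exact: H xy _ _ erefl erefl.
  elim=> [{}u {}v [uA vA uv] a b ea eb|{}u a b -> /finj->|{}u w {}v _ uw _ wv a b ea eb].
  - apply: rt_step; rewrite ea eb in uA vA uv.
    by split; [apply/image_inP|apply/image_inP|apply/(aut_adj f)].
  - exact: rt_refl.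
  - by have [d ed] := fsurj w; apply: rt_trans (uw a d ea (esym ed)) (wv d b (esym ed) eb).
elim=> [u v [Au Av uv]|u|u v w _ uv _ vw]; last exact: rt_trans uv vw.
  by apply: rt_step; split; [exists u|exists v|apply/aut_adj].
exact: rt_refl.
Qed.

Lemma component_aut A z : component (f @` A) (f z) = f @` component A z.
Proof.
by apply: image_eq => x; rewrite /component /= common_nbhd_aut; apply: linked_aut.
Qed.

Lemma parent_aut A B : parent (f @` A) (f @` B) <-> parent A B.
Proof.
split=> -[ne [z Nz e]].
  split=> [eAB|]; first by apply: ne; rewrite eAB.
  have [x ex] := fsurj z; rewrite -ex in Nz e.
  exists x; first by move: Nz; rewrite common_nbhd_aut => /image_inP.
  by apply: image_aut_inj; rewrite e component_aut core_aut image_setU.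
split=> [/image_aut_inj//|]; exists (f z); first by rewrite common_nbhd_aut; exists z.
by rewrite e component_aut core_aut image_setU.
Qed.

Lemma nonempty_cliques_aut A : nonempty_cliques (f @` A) <-> nonempty_cliques A.
Proof.
split=> -[/clique_aut cA [x Ax]]; split=> //.
  by case: Ax => a Aa _; exists a.
by exists (f x); exists x.
Qed.

Definition act_fun (h : core_graph) : core_graph :=
  exist _ (f @` node_label h) (mem_set ((nonempty_cliques_aut _).2 (node_labelP h))).

Lemma act_bij : bijective act_fun.
Proof.
have inv (h : core_graph) : exists k : core_graph, f @` node_label k = node_label h.
  have e : f @` (f @^-1` node_label h) = node_label h.
    by apply/esym/image_eq.
  have hP : nonempty_cliques (f @^-1` node_label h).
    by apply/nonempty_cliques_aut; rewrite e; apply: node_labelP.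
  by exists (exist _ (f @^-1` node_label h) (mem_set hP)).
have [g gE] := choice inv; exists g => h; apply: val_inj; last exact: gE.
by apply: image_aut_inj; apply: gE.
Qed.

Lemma act_adj h k : @adj core_graph (act_fun h) (act_fun k) <-> adj h k.
Proof. by rewrite /adj /= !parent_aut. Qed.

Definition core_act : aut core_graph := Aut act_bij act_adj.

End Automorphism.

Lemma core_graph_canonical : canonical_representation (label_region node_label).
Proof.
exists core_act; split.
  split=> [h|f g h]; apply: val_inj; first exact: image_id.
  exact/esym/image_comp.
move=> f v; have finj := bij_inj (aut_bij f).
have inE x (h : core_graph) : node_label (act_fun f h) (f x) <-> node_label h x.
  by split=> [[y hy /finj<-]|]; [|exists x].
have [g gK Kg] := act_bij f.
apply: subgraph_eq.
  apply/seteqP; split=> [_ [h hv <-]|h hv]; first exact/inE.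
  by exists (g h); rewrite /= ?Kg //; apply/inE; rewrite Kg.
apply/funext => h; apply/funext => k; apply/propext; split.
  by move=> [a [b [[ab av bv] <- <-]]]; split; [apply/act_adj|apply/inE|apply/inE].
rewrite -(Kg h) -(Kg k) => -[/act_adj ab /inE av /inE bv].
by exists (g h), (g k).
Qed.

End CanonicalGraph.

(** * Region representations and decompositions into cliques *)

Section Decompositions.
Variables (G H : graph) (R : G -> subgraph H).

Lemma regions_decomposition : region_representation R ->
  graph_decomposition (fun h => [set v | sverts (R v) h]) R /\
  into_cliques (fun h => [set v | sverts (R v) h]).
Proof.
move=> [reg meet]; split; last first.
  by move=> h u v hu hv uv; apply/(meet u v uv); exists h.
have sub v : forall x y, sedge (R v) x y ->
    sedge (induced [set h | sverts (R v) h]) x y.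
  move=> x y xy; split; [exact: sedge_vert xy|exact: sedge_vertr xy|].
  exact: sedge_adj xy.
split=> [|v|v].
- apply: subgraph_eq.
    apply/seteqP; split=> // v _; have [[h hv] _] := reg v.
    by exists h.
  apply/funext => u; apply/funext => v; apply/propext; split=> [uv|[h _ []]//].
  have uv' : u <> v by move=> e; move: uv; rewrite e => /adj_irrefl.
  by have [h [hu hv]] := (meet u v uv').1 uv; exists h.
- apply/connectedP => a b [_ av] [_ bv]; apply: reach_mono (sub v) _.
  by have [_ /connectedP] := reg v; apply.
- split; last by have [] := reg v.
  by split; [rewrite /= setTI|exact: sub].
Qed.

Lemma decomposition_regions (V : H -> set G) :
  graph_decomposition V R -> into_cliques V -> region_representation R.
Proof.
move=> [GV _ co] cV; have RV v h : sverts (R v) h <-> V h v.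
  by have [[-> _] _] := co v; split=> [[]|].
split=> [v|u v uv].
  split; last by have [] := co v.
  have : sverts (whole G) v by [].
  by rewrite GV => -[h _ [_ hv]]; exists h; apply/RV.
split=> [|[h [/RV hu /RV hv]]]; last exact: cV hu hv uv.
have : adj u v -> sedge (whole G) u v by [].
rewrite GV => uvE /uvE[h _ [hu hv _]].
by exists h; split; apply/RV.
Qed.

Lemma canonical_regions_decomposition : canonical_representation R ->
  canonical_decomposition (fun h => [set v | sverts (R v) h]) R.
Proof.
move=> [act [act_act actR]]; exists act; split=> // f; split=> // h.
have imR v : act f @` sverts (R v) = sverts (R (f v)) by rewrite -actR.
apply/seteqP; split=> [_ [v hv <-]|u] /=.
  by rewrite -imR; exists h.
have [g _ gK] := aut_bij f; rewrite -(gK u) -imR => -[h' h'u].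
by move=> /(bij_inj (aut_bij (act f))) e; exists (g u) => //=; rewrite -e.
Qed.

End Decompositions.

Lemma locally_chordal_regions (G K : graph) (V : K -> set G) r :
  locally_finite G -> 3 <= r -> locally_chordal G r -> star_system V ->
  region_representation (label_region V) /\ r_acyclic r (label_region V).
Proof.
move=> lf r3 lc ss; split; first exact: label_region_representation.
apply: label_r_acyclic => // [x|n c nr cc]; first exact: nbhd_chordal r3 lc.
exact: short_cycle_chord lc nr cc.
Qed.

(** The regions of a clique graph [H] only use edges of [H], so they may be
    taken over [H] itself instead of the clique intersection graph. *)
Lemma clique_graph_decomposition (G : graph) r
    (H : subgraph (clique_intersection_graph G)) :
  clique_graph H -> r_acyclic r (clique_region H) ->
  exists (K : graph) (V : K -> set G) (R : G -> subgraph K),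
    [/\ graph_decomposition V R, into_max_cliques V & r_acyclic r R].
Proof.
move=> [[HT _] co] ac; pose V (h : edge_graph H) : set G := val h.
have cliqueV h : clique (V h) := @max_clique_clique G h.
have rep : region_representation (label_region V).
  split=> [v|u v uv].
    have cv : clique [set v] by move=> _ _ -> -> [].
    have [h hv] := clique_max_clique cv.
    split; first by exists h; apply: hv.
    apply/connectedP => a b av bv; have /connectedP := co v.
    move=> /(_ a b) vab; apply: reach_mono (vab _ _); last by rewrite /= HT.
      by move=> x y [].
    by rewrite /= HT.
  split=> [ad|[h [hu hv]]]; last exact: cliqueV hu hv uv.
  have cuv : clique [set u; v].
    by move=> x y [->|->] [->|->] // _; apply: adj_sym.
  have [h hP] := clique_max_clique cuv.
  by exists h; split; apply: hP; [left|right].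
exists (edge_graph H), V, (label_region V); split.
- by have [] := regions_decomposition rep.
- split=> [h _|h k _ _|A mA]; first exact: max_cliqueP.
    exact: val_inj.
  by exists (exist _ A (mem_set mA)).
move=> X Xr; apply/acyclicP; have /acyclicP := ac X Xr.
by apply: forest_sub => a b [x Xx [ab ax bx]]; exists x.
Qed.

Theorem theorem3 (G : graph) (r : nat) (hG : locally_finite G) (hr : 3 <= r) :
  [<-> (* (i) *)
       locally_chordal G r;
       (* (ii) *)
       exists H : subgraph (clique_intersection_graph G),
         clique_graph H /\ r_acyclic r (clique_region H);
       (* (ii), decomposition form *)
       exists (H : graph) (V : H -> set G) (R : G -> subgraph H),
         [/\ graph_decomposition V R, into_max_cliques V & r_acyclic r R];
       (* (iii) *)
       exists (H : graph) (R : G -> subgraph H),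
         [/\ region_representation R, r_acyclic r R
           & canonical_representation R];
       (* (iii), decomposition form *)
       exists (H : graph) (V : H -> set G) (R : G -> subgraph H),
         [/\ graph_decomposition V R, into_cliques V, r_acyclic r R
           & canonical_decomposition V R];
       (* (iv) *)
       exists (H : graph) (R : G -> subgraph H),
         region_representation R /\ r_acyclic r R;
       (* (iv), decomposition form *)
       exists (H : graph) (V : H -> set G) (R : G -> subgraph H),
         [/\ graph_decomposition V R, into_cliques V & r_acyclic r R]].
Proof.
tfae.
- move=> lc; have [H [HT ss]] := exists_star_clique_graph G.
  have [[reg _] ac] := locally_chordal_regions hG hr lc ss.
  exists H; split.
    split=> [|v]; first by split=> // x y; apply: sedge_adj.
    apply/connectedP => a b [_ av] [_ bv]; have [_ /connectedP] := reg v.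
    by move=> /(_ a b av bv); apply: reach_mono => x y [].
  move=> X Xr; apply/acyclicP; have /acyclicP := ac X Xr.
  by apply: forest_sub => a b [x Xx [ax bx ab]]; exists x.
- by move=> [H [cg ac]]; apply: clique_graph_decomposition cg ac.
- move=> [H [V [R [dec [mV _ _] ac]]]].
  have cV : into_cliques V by move=> h; case: (mV h I).
  have lc := regions_locally_chordal (decomposition_regions dec cV) ac.
  have ch x : chordal_on (closed_nbhd x) := @nbhd_chordal G r x hr lc.
  have [reg ac'] := locally_chordal_regions hG hr lc (core_graph_star hG ch).
  exists (core_graph G), (label_region (@node_label G)); split=> //.
  exact: core_graph_canonical.
- move=> [H [R [rep ac can]]]; have [dec cl] := regions_decomposition rep.
  exists H, (fun h => [set v | sverts (R v) h]), R; split=> //.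
  exact: canonical_regions_decomposition.
- move=> [H [V [R [dec cl ac _]]]]; exists H, R; split=> //.
  exact: decomposition_regions dec cl.
- move=> [H [R [rep ac]]]; have [dec cl] := regions_decomposition rep.
  by exists H, (fun h => [set v | sverts (R v) h]), R.
- move=> [H [V [R [dec cl ac]]]].
  exact: regions_locally_chordal (decomposition_regions dec cl) ac.
Qed.
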